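(* Let $(X_i)_{i\ge1}$ be i.i.d. real random variables such that $X_1$ admits a first-order score function $\mathfrak{s}_{X_1}\in L^4(X_1)$ and $X_1\in[a,b]$ for some $a>0$. Let $$U_n:=\frac{1}{\sqrt n\,(n-1)}\sum_{1\le i\ne j\le n}\big(X_iX_j-\mathbb{E}[X_iX_j]\big),\qquad \sigma^2:=4\,\mathbb{E}[X_1]^2\,\mathrm{Var}(X_1),\quad\sigma>0.$$ Then $$\big|\sqrt{\mathbb{P}(U_n>\sigma u)}-\sqrt{\Phi^c(u)}\big|\lessapprox\frac{\log(n)}{\sqrt n}\,\frac{\sqrt2\,\mathbb{E}[X_1^4]}{\sigma^2}\,(8\sqrt2+2)\qquad\text{for all }u\in\mathbb{R}.$$
   Context: $\Phi$ is the standard normal cumulative distribution function and $\Phi^c:=1-\Phi$. $L^p(S):=\{f:\mathbb{R}\to\mathbb{R}\text{ measurable}:\mathbb{E}[|f(S)|^p]<\infty\}$. $C_c^\infty$ is the set of infinitely differentiable compactly supported functions $\mathbb{R}\to\mathbb{R}$. A random variable $S$ admits a (first-order) score function $\mathfrak{s}_S\in L^1(S)$ if $\mathbb{E}[\mathfrak{s}_S(S)\Psi(S)]=-\mathbb{E}[\Psi'(S)]$ for all $\Psi\in C_c^\infty$. $a_n\lessapprox b_n$ means $a_n\le b_n+o(b_n)$ as $n\to\infty$. ($\sigma$ denotes the positive square root of $\sigma^2$.) *)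

(* Defs.v *)
From HB Require Import structures.
From mathcomp Require Export all_boot all_order all_algebra.
From mathcomp Require Export all_classical all_reals all_analysis.
Export Order.TTheory GRing.Theory Num.Theory.
Export numFieldNormedType.Exports.

Set Implicit Arguments.
Unset Strict Implicit.
Unset Printing Implicit Defensive.

Local Open Scope classical_set_scope.
Local Open Scope ring_scope.

Definition Phi (R : realType) (u : R) : R :=
  fine (normal_prob (0 : R) 1 `]-oo, u]).

Definition Phic (R : realType) (u : R) : R := 1 - Phi u.

Definition mutually_independent (d : measure_display) (T : measurableType d)
    (R : realType) (P : probability T R) (X : nat -> {RV P >-> R}) : Prop :=
  forall (J : seq nat) (B : nat -> set R), uniq J ->
    (forall i, measurable (B i)) ->
    P (\bigcap_(i in [set` J]) (X i @^-1` B i)) =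
    (\prod_(i <- J) P (X i @^-1` B i))%E.

Definition identically_distributed (d : measure_display)
    (T : measurableType d) (R : realType) (P : probability T R)
    (X : nat -> {RV P >-> R}) : Prop :=
  forall (i j : nat) (B : set R), measurable B ->
    distribution P (X i) B = distribution P (X j) B.

(* L^p(S): functions of S, not functions on the sample space. *)
Definition Lp (d : measure_display) (T : measurableType d) (R : realType)
    (P : probability T R) (S : {RV P >-> R}) (p : R) : set (R -> R) :=
  [set f : R -> R | measurable_fun [set: R] f /\
           ('E_P[fun w => (`|f (S w)| `^ p)%R] < +oo)%E].

Definition Cc_infty (R : realType) : set (R -> R) :=
  [set f : R -> R |
    (forall (k : nat) (x : R), derivable (f^`(k))%classic x 1) /\
    compact (closure [set x | f x != 0])].

Definition is_score (d : measure_display) (T : measurableType d)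
    (R : realType) (P : probability T R) (S : {RV P >-> R})
    (s : R -> R) : Prop :=
  Lp S 1 s /\
  forall Psi : R -> R, Cc_infty Psi ->
    ('E_P[fun w => (s (S w) * Psi (S w))%R] =
     - 'E_P[fun w => (Psi^`())%classic (S w)])%E.

(* The sequence X_1, X_2, ... is indexed from 0: X_i is [X i.-1]. *)
Definition Ustat (d : measure_display) (T : measurableType d) (R : realType)
    (P : probability T R) (X : nat -> {RV P >-> R}) (n : nat) (w : T) : R :=
  (Num.sqrt n%:R * (n%:R - 1))^-1 *
  \sum_(i < n) \sum_(j < n | j != i)
    (X i w * X j w - fine 'E_P[fun w' => (X i w' * X j w')%R]%E).

(* a_n(t) <= b_n + o(b_n) for all t: as b does not depend on t, neither does
   the error term o(b_n), so the relation is uniform in t. *)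
Definition lessapprox (T : Type) (R : realType) (a : nat -> T -> R)
    (b : nat -> R) : Prop :=
  exists2 r : nat -> R, r =o_\oo b &
    \forall n \near \oo, forall t, a n t <= b n + r n.

(* Main.v *)
(** Let [W] be the normalized sum of the [X_i]. Up to [O(1 / sqrt n)], [U_n / sigma] is the
    function [W + c W^2 / sqrt n], increasing on the range of [W] because [X_i > 0]; as the
    slope of [sqrt Phic] at [u] is [O(1 / (1 + u^2))], it suffices to compare
    [p v = P (W > v)] with [Phic v] on the square-root scale.

    Summing the score identity over the summands, [E[(sum_i s(X_i)) Psi(S)] = - n E[Psi'(S)]],
    and applying Cauchy-Schwarz to a smooth step [Psi] gives the concentration bound
    [P (v + h < W <= v + 2 h) <= C h sqrt (p v)]. Leaving one summand out, it follows that
    [|p v - E[W (W - v)^+]| <= eps sqrt (p (v - delta))] with [eps, delta = O(1 / sqrt n)].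

    The functions [r v = E (W - v)^+] and [G v = E[W (W - v)^+]] satisfy [r' = - p] and
    [G' = - (r + v p)]. Substituting [p = G + error] this is a linear system, solved by
    [G = Phic] when the error vanishes; variation of constants yields
    [|p - Phic| <= eps (4 sqrt Phic + 3 (D + 8 delta))] with [D = sup |sqrt p - sqrt Phic|], and
    [D] is absorbed. The outcome is a bound in [O(1 / sqrt n)], below [log n / sqrt n] times
    any positive constant for large [n]. *)

(* The square root is the natural scale because every error comes from Cauchy-Schwarz or from
   concentration and therefore carries a factor [sqrt p], which is lost again when [p - Phic] is
   divided by [sqrt p + sqrt Phic]. The obstacle is the half of the variation of constants that
   integrates from the left: it collects errors at points [x < v], where [sqrt p] is larger than at
   [v], so monotonicity of [p] is of no help. There [sqrt p] is replaced by [sqrt Phic + D]. Mills'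
   inequality handles the first term, and the second leaves a product [eps * D]. This product is
   harmless on the square-root scale: a gap [d] between nonnegative roots satisfies
   [d^2 <= |p - Phic|], and [sqrt (eps * D)] is at most a multiple of [eps] plus a fraction of [D].
   Hence the absorption of [D] asks for no smallness of [eps]. Boundedness of the summands makes [r]
   and [G] explicit outside a compact interval, so the boundary values of the system are exact, and
   integrals are replaced throughout by comparison of derivatives. *)
From HB Require Import structures.
Require Import Defs.
From mathcomp Require Import measurable_realfun ring lra.

Set Implicit Arguments.
Unset Strict Implicit.
Unset Printing Implicit Defensive.

Local Open Scope classical_set_scope.
Local Open Scope ring_scope.

(** * Derivatives and monotonicity *)

Section Calculus.
Context {R : realType}.
Implicit Types (f g : R -> R) (x a b c : R).

Lemma is_derive_conv f x a b : is_derive x 1 f a -> a = b -> is_derive x 1 f b.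
Proof. by move=> df <-. Qed.

Lemma is_derive_addf f g x a b : is_derive x 1 f a -> is_derive x 1 g b ->
  is_derive x 1 (fun t => f t + g t) (a + b).
Proof. exact: is_deriveD. Qed.

Lemma is_derive_subf f g x a b : is_derive x 1 f a -> is_derive x 1 g b ->
  is_derive x 1 (fun t => f t - g t) (a - b).
Proof. exact: is_deriveB. Qed.

Lemma is_derive_oppf f x a : is_derive x 1 f a ->
  is_derive x 1 (fun t => - f t) (- a).
Proof. exact: is_deriveN. Qed.

Lemma is_derive_mulf f g x a b : is_derive x 1 f a -> is_derive x 1 g b ->
  is_derive x 1 (fun t => f t * g t) (a * g x + f x * b).
Proof.
move=> df dg; have := @is_deriveM _ _ f g x 1 a b df dg.
by move/is_derive_conv; apply; rewrite /GRing.scale /= addrC mulrC.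
Qed.

Lemma is_derive_cstf c x : is_derive x 1 (fun=> c) 0.
Proof. exact: is_derive_cst. Qed.

Lemma is_derive_idf x : is_derive x 1 (fun t => t) 1.
Proof. exact: is_derive_id. Qed.

Lemma is_derive_invf f x a : f x != 0 -> is_derive x 1 f a ->
  is_derive x 1 (fun t => (f t)^-1) (- a / f x ^+ 2).
Proof.
move=> fx0 df; have := @is_deriveV _ f x a 1 fx0 df.
by move/is_derive_conv; apply; rewrite /GRing.scale /= mulNr mulrC mulNr.
Qed.

Lemma is_derive_compf f g x a b : is_derive (g x) 1 f a -> is_derive x 1 g b ->
  is_derive x 1 (fun t => f (g t)) (a * b).
Proof. by move=> df dg; exact: is_derive1_comp. Qed.

Lemma is_derive_expnf f n x a : is_derive x 1 f a ->
  is_derive x 1 (fun t => f t ^+ n) (n%:R * f x ^+ n.-1 * a).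
Proof.
move=> df; have -> : (fun t => f t ^+ n) = f ^+ n by apply/funext => t; rewrite exprfctE.
apply: is_derive_conv (@is_deriveX _ _ f n x 1 a df) _; case: n => [|n].
  by rewrite mulr0n !mul0r scale0r.
by [].
Qed.

Lemma is_derive_continuous f x a : is_derive x 1 f a -> {for x, continuous f}.
Proof.
by move=> df; apply/differentiable_continuous/derivable1_diffP; case: df.
Qed.

Lemma is_derive_le f f' a b : a <= b ->
  (forall x, a <= x <= b -> is_derive x 1 f (f' x)) ->
  (forall x, a <= x <= b -> 0 <= f' x) -> f a <= f b.
Proof.
move=> ab df f'0; have [x|/=|c] := @MVT_segment R f f' a b ab.
- by rewrite in_itv /= => /andP[ax xb]; apply: df; rewrite !ltW.
- apply: continuous_in_subspaceT => x; rewrite inE /= in_itv /= => xab.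
  exact: is_derive_continuous (df x xab).
- rewrite in_itv /= => /f'0 fc0 fba.
  by rewrite -subr_ge0 fba mulr_ge0 // subr_ge0.
Qed.

(** The common pattern of the Mills-type inequalities below: the difference of the two sides
    vanishes at [-oo] and has a derivative of constant sign. *)
Lemma nondecreasing_cvgNy_ge0 f b : (forall x y, x <= y -> y <= b -> f x <= f y) ->
  f x @[x --> -oo] --> (0 : R) -> 0 <= f b.
Proof.
move=> fnd f0; rewrite -(cvg_lim _ f0) //.
apply: limr_le; first by apply/cvg_ex; exists 0.
by near=> y; apply: fnd => //; near: y; exact: nbhs_ninfty_le (num_real b).
Unshelve. all: by end_near. Qed.

Lemma cvgNy0_bound f C : (forall x, `|f x| * (1 + x ^+ 2) <= C) ->
  f x @[x --> -oo] --> (0 : R).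
Proof.
move=> fC; apply/cvgrPdist_lt => e e0; near=> x; rewrite sub0r normrN.
have x2 : 0 <= x ^+ 2 by rewrite sqr_ge0.
rewrite -(@ltr_pM2r _ (1 + x ^+ 2)); last by lra.
apply: le_lt_trans (fC x) _.
have xC : x <= - (`|C| / e) - 1.
  by near: x; exact: nbhs_ninfty_le (num_real _).
have C0 : 0 <= `|C| / e by rewrite divr_ge0 // ltW.
rewrite -ltr_pdivrMl //; apply: le_lt_trans (_ : `|C| / e < _); last by nra.
by rewrite mulrC ler_pM2r ?invr_gt0 // ler_norm.
Unshelve. all: by end_near. Qed.

End Calculus.

Definition gauss {R : realType} (u : R) : R := normal_pdf 0 1 u.

(** * The Gaussian tail *)

Section Gaussian.
Context {R : realType}.
Implicit Types u v : R.
Local Notation phi := (@gauss R).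
Local Notation Phi := (@Phi R).
Local Notation q := (@Phic R).

Lemma gaussE u : phi u = normal_peak 1 * expR (- u ^+ 2 / 2).
Proof. by rewrite /gauss normal_pdfE ?oner_neq0 // /normal_fun subr0 expr1n. Qed.

Lemma gauss_gt0 u : 0 < phi u.
Proof. by rewrite gaussE mulr_gt0 ?expR_gt0 ?normal_peak_gt0 ?oner_neq0. Qed.

Lemma is_derive_gauss u : is_derive u 1 phi (- u * phi u).
Proof.
have -> : phi = (fun u => normal_peak 1 * expR (- u ^+ 2 / 2)).
  by apply/funext => v; rewrite gaussE.
have D : is_derive u 1 (fun t : R => - t ^+ 2 / 2) (- u).
  have := is_derive_mulf (is_derive_oppf (is_derive_expnf 2 (is_derive_idf u)))
            (is_derive_cstf 2^-1 u).
  by move/is_derive_conv; apply; rewrite /=; field.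
have := is_derive_mulf (is_derive_cstf (normal_peak 1) u)
          (is_derive_compf (is_derive_expR _) D).
by move/is_derive_conv; apply; ring.
Qed.

Lemma is_derive_Phi u : is_derive u 1 Phi (phi u).
Proof.
have [] := @continuous_FTC1 R (phi : R -> R) -oo%O u (u + 1).
- by rewrite ltrDl.
- apply: (integrableS _ _ (subsetT _)) => //; exact: integrable_normal_pdf.
- by rewrite ltNyr.
- by move=> A; apply: (continuous_normal_pdf (oner_neq0 _)).
move=> dF dE; split; first exact: dF.
by rewrite -derive1E; exact: dE.
Qed.

(** Under [normal_prob 0 1] the identity is a standard normal variable, so [Phi] becomes a [cdf] and
    inherits the limits of cumulative distribution functions. *)
Definition idRV : measurableTypeR R -> R := idfun.

HB.instance Definition _ :=
  @isMeasurableFun.Build _ _ _ _ idRV (@measurable_id _ _ setT).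

Lemma PhiE u : Phi u = fine (cdf (idRV : {RV normal_prob (0 : R) 1 >-> R}) u).
Proof. by []. Qed.

Lemma Phi_cvgNy : Phi u @[u --> -oo] --> (0 : R).
Proof.
by under eq_fun do rewrite PhiE; apply: fine_cvg; apply: cvg_cdfNy0.
Qed.

Lemma Phi_cvgy : Phi u @[u --> +oo] --> (1 : R).
Proof.
by under eq_fun do rewrite PhiE; apply: fine_cvg; exact: cvg_cdfy1.
Qed.

Lemma normal_peak_le : normal_peak (1 : R) <= 2^-1.
Proof.
rewrite /normal_peak lef_pV2 ?posrE ?sqrtr_gt0 //; last first.
  by rewrite expr1n mul1r mulrn_wgt0 // pi_gt0.
rewrite -[leLHS]ger0_norm // -sqrtr_sqr ler_wsqrtr // expr1n mul1r.
have := @pi_ge2 R; rewrite mulr2n; lra.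
Qed.

(** Cubing [(1 + u^2) / 6 <= 1 + u^2 / 6 <= exp (u^2 / 6)] gives [(1 + u^2)^3 <= 216 exp (u^2 / 2)],
    and the peak [1 / sqrt (2 pi)] is at most [1 / 2], whence 108. *)
Lemma gauss_decay u : phi u * (1 + u ^+ 2) ^+ 3 <= 108.
Proof.
have u2 : 0 <= u ^+ 2 by rewrite sqr_ge0.
have e0 := expR_gt0 (u ^+ 2 / 6 : R).
have eE : expR (- u ^+ 2 / 2) = (expR (u ^+ 2 / 6) ^+ 3)^-1.
  by rewrite -expRM_natl -expRN; congr expR; field.
have le6 : (1 + u ^+ 2) / 6 <= expR (u ^+ 2 / 6).
  apply: le_trans (expR_ge1Dx _); lra.
rewrite gaussE eE mulrAC ler_pdivrMr ?exprn_gt0 //.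
have le3 : (1 + u ^+ 2) ^+ 3 <= 216 * expR (u ^+ 2 / 6) ^+ 3.
  have -> : (216 : R) = 6 ^+ 3 by ring.
  rewrite -exprMn lerXn2r ?nnegrE; lra.
have p0 := normal_peak_ge0 (1 : R); have p2 := normal_peak_le.
apply: le_trans (ler_wpM2l p0 le3) _.
have : 0 <= expR (u ^+ 2 / 6) ^+ 3 by rewrite exprn_ge0 // ltW.
nra.
Qed.

Lemma gaussN u : phi (- u) = phi u.
Proof. by rewrite !gaussE sqrrN. Qed.

(** The function [Phi (- t) + Phi t - 1] has derivative 0 and limit 0 at [-oo]; the monotonicity
    criterion applies to it and to its opposite. *)
Lemma PhiN u : Phi (- u) = q u.
Proof.
have D v : is_derive v 1 (fun t => Phi (- t) + Phi t - 1) 0.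
  have := is_derive_compf (is_derive_Phi (- v)) (is_derive_oppf (is_derive_idf v)).
  move=> D; apply: is_derive_conv (is_derive_subf (is_derive_addf D
    (is_derive_Phi v)) (is_derive_cstf 1 v)) _.
  by rewrite gaussN; ring.
have L : Phi (- t) + Phi t - 1 @[t --> -oo] --> (0 : R).
  rewrite (cvgNy_compNP (fun t => Phi (- t) + Phi t - 1)).
  have := Phi_cvgNy; rewrite cvgNy_compNP => L.
  rewrite (_ : _ \o _ = (fun t => Phi t + (Phi \o -%R) t - 1)); last first.
    by apply/funext => t; rewrite /= opprK.
  have := cvgB (cvgD Phi_cvgy L) (cvg_cst (1 : R)); rewrite addr0 subrr.
  by move=> /(_ _ _ _); apply.
pose h t := Phi (- t) + Phi t - 1.
have h_ge0 : 0 <= h u.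
  apply: (@nondecreasing_cvgNy_ge0 R h u _ L) => x y xy _.
  by apply: (@is_derive_le R h (fun=> 0) x y xy) => // v _; exact: D.
have h_le0 : 0 <= - h u.
  apply: (@nondecreasing_cvgNy_ge0 R (fun t => - h t) u) => [x y xy _|].
    refine (@is_derive_le R (fun t => - h t) (fun=> - 0) x y xy _ _) => v _.
    by rewrite oppr0.
  by rewrite -[X in _ --> X]oppr0; exact: cvgN.
by move: h_ge0 h_le0; rewrite /h /Phic; lra.
Qed.

Lemma is_derive_Phic u : is_derive u 1 q (- phi u).
Proof.
apply: is_derive_conv (is_derive_subf (is_derive_cstf 1 u) (is_derive_Phi u)) _.
by rewrite sub0r.
Qed.

Lemma PhicN u : q (- u) = Phi u. Proof. by rewrite -PhiN opprK. Qed.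

Lemma Phi_ge0 u : 0 <= Phi u.
Proof. exact: fine_ge0. Qed.

Lemma Phi_gt0 u : 0 < Phi u.
Proof.
have u1 : u - 1 < u by rewrite ltrBlDr ltrDl.
have [] := @MVT R Phi phi (u - 1) u u1.
- by move=> x _; exact: is_derive_Phi.
- apply: continuous_in_subspaceT => x _.
  exact: is_derive_continuous (is_derive_Phi x).
- move=> c _ Pc; have := Phi_ge0 (u - 1); have := gauss_gt0 c.
  by move: Pc; rewrite subKr mulr1; lra.
Qed.

Lemma Phic_gt0 u : 0 < q u.
Proof. by rewrite -PhiN Phi_gt0. Qed.

Lemma add1sqr_gt0 u : 0 < 1 + u ^+ 2.
Proof. by rewrite ltr_pwDl // sqr_ge0. Qed.

Lemma gauss_decay1 u : phi u * (1 + u ^+ 2) <= 108.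
Proof.
apply: le_trans (gauss_decay u); rewrite ler_pM2l ?gauss_gt0 //.
have u2 : 0 <= u ^+ 2 by rewrite sqr_ge0.
nra.
Qed.

Lemma gauss_le u : phi u <= 108.
Proof.
apply: le_trans (gauss_decay1 u); rewrite ler_peMr ?(ltW (gauss_gt0 _)) //.
by rewrite lerDl sqr_ge0.
Qed.

(** The lower Mills bound, equivalent to convexity of [Phi / phi]. It holds because
    [Phi + v phi / (1 + v^2)] has derivative [2 phi / (1 + v^2)^2]. *)
Lemma Mills2 u : 0 <= u * phi u + (1 + u ^+ 2) * Phi u.
Proof.
pose h v := Phi v + v * phi v / (1 + v ^+ 2).
have D v : is_derive v 1 h (2 * phi v / (1 + v ^+ 2) ^+ 2).
  have v0 : 1 + v ^+ 2 != 0 by rewrite gt_eqF // add1sqr_gt0.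
  have dV : is_derive v 1 (fun t : R => (1 + t ^+ 2)^-1) (- (2 * v) / (1 + v ^+ 2) ^+ 2).
    apply: is_derive_conv (@is_derive_invf _ (fun t => 1 + t ^+ 2) v _ v0 (is_derive_addf (is_derive_cstf 1 v)
      (is_derive_expnf 2 (is_derive_idf v)))) _.
    by rewrite /=; congr (- _ / _); ring.
  apply: is_derive_conv (is_derive_addf (is_derive_Phi v) (is_derive_mulf
    (is_derive_mulf (is_derive_idf v) (is_derive_gauss v)) dV)) _.
  by field.
have L : h v @[v --> -oo] --> (0 : R).
  rewrite -[X in _ --> X]addr0; apply: cvgD; first exact: Phi_cvgNy.
  apply: (@cvgNy0_bound _ _ 108) => v.
  have v0 := add1sqr_gt0 v.
  rewrite normrM (@gtr0_norm _ _^-1) ?invr_gt0 // divfK ?gt_eqF //.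
  apply: le_trans (gauss_decay1 v); rewrite normrM mulrC (gtr0_norm (gauss_gt0 _)).
  rewrite ler_pM2l ?gauss_gt0 //.
  have := sqr_ge0 (`|v| - 1); rewrite -(real_normK (num_real v)); nra.
have h0 : 0 <= h u.
  apply: (@nondecreasing_cvgNy_ge0 R h u _ L) => x y xy _.
  apply: (@is_derive_le R h _ x y xy (fun v _ => D v)) => v _.
  by rewrite divr_ge0 ?exprn_ge0 ?mulr_ge0 // ltW ?gauss_gt0 ?add1sqr_gt0.
have u0 := add1sqr_gt0 u.
suff -> : u * phi u + (1 + u ^+ 2) * Phi u = (1 + u ^+ 2) * h u.
  by rewrite mulr_ge0 // ltW.
by rewrite /h; field; rewrite gt_eqF.
Qed.

(** The upper Mills bound, equivalent to monotonicity of [Phi / phi]. Only negative [u] are at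
    stake, and there [- (Phi + phi / v)] has derivative [phi / v^2]. *)
Lemma Phi_Mills u : 0 <= phi u + u * Phi u.
Proof.
have [u0|u0] := leP 0 u; first by rewrite addr_ge0 ?mulr_ge0 // ltW ?gauss_gt0 ?Phi_gt0.
pose h v := - (Phi v + phi v / v).
have D v : v < 0 -> is_derive v 1 h (phi v / v ^+ 2).
  move=> v0; have v1 : v != 0 by rewrite lt_eqF.
  apply: is_derive_conv (is_derive_oppf (is_derive_addf (is_derive_Phi v)
   (is_derive_mulf (is_derive_gauss v) (@is_derive_invf _ id v _ v1 (is_derive_idf v))))) _.
  by field.
have L : h v @[v --> -oo] --> (0 : R).
  rewrite -[X in _ --> X]oppr0; apply: cvgN; rewrite -[X in _ --> X]addr0.
  apply: cvgD; first exact: Phi_cvgNy.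
  rewrite -[X in _ --> X](mulr0 0); apply: cvgM.
    apply: (@cvgNy0_bound _ _ 108) => v.
    by rewrite (gtr0_norm (gauss_gt0 _)) gauss_decay1.
  apply/cvgrPdist_lt => e e0; near=> x; rewrite sub0r normrN.
  have x0 : x < - e^-1 by near: x; exact: nbhs_ninfty_lt (num_real _).
  have e1 : 0 < e^-1 by rewrite invr_gt0.
  rewrite normfV invf_plt ?posrE ?normr_gt0 //; last by rewrite lt_eqF //; lra.
  by rewrite ltr0_norm; lra.
have h0 : 0 <= h u.
  apply: (@nondecreasing_cvgNy_ge0 R h u _ L) => x y xy yu.
  have {}D v : x <= v <= y -> is_derive v 1 h (phi v / v ^+ 2).
    by move=> /andP[_ vy]; apply: D; lra.
  apply: (@is_derive_le R h _ x y xy D) => v _.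
  by rewrite divr_ge0 ?sqr_ge0 // ltW ?gauss_gt0.
have -> : phi u + u * Phi u = - u * h u by rewrite /h; field; rewrite lt_eqF.
by rewrite mulr_ge0 //; lra.
Unshelve. all: by end_near. Qed.

Lemma Phic_Mills u : u * q u <= phi u.
Proof. by have := Phi_Mills (- u); rewrite gaussN PhiN; lra. Qed.

(** Read at [- u], this controls the slope [phi / (2 sqrt Phic)] of [sqrt Phic]. The derivative of
    the left side is at most [2 phi^2 (1 + v^2)^3] in absolute value, hence at most [216 phi] by
    [gauss_decay]. *)
Lemma Phi_lower u : phi u ^+ 2 * (1 + u ^+ 2) ^+ 2 <= 216 * Phi u.
Proof.
pose h v := 216 * Phi v - phi v ^+ 2 * (1 + v ^+ 2) ^+ 2.
have D v : is_derive v 1 h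
    (phi v * (216 + 2 * v * phi v * (1 + v ^+ 2) * (v ^+ 2 - 1))).
  apply: is_derive_conv (is_derive_subf (is_derive_mulf (is_derive_cstf 216 v)
    (is_derive_Phi v)) (is_derive_mulf (is_derive_expnf 2 (is_derive_gauss v))
    (is_derive_expnf 2 (is_derive_addf (is_derive_cstf 1 v)
      (is_derive_expnf 2 (is_derive_idf v)))))) _.
  by rewrite /=; ring.
have L : h v @[v --> -oo] --> (0 : R).
  rewrite -[X in _ --> X]subr0; apply: cvgB.
    by rewrite -[X in _ --> X](mulr0 216); apply: cvgMr; exact: Phi_cvgNy.
  apply: (@cvgNy0_bound _ _ (108 * 108)) => v.
  have v0 := add1sqr_gt0 v; have p0 := gauss_gt0 v.
  rewrite ger0_norm; last exact: mulr_ge0 (sqr_ge0 _) (sqr_ge0 _).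
  have -> : phi v ^+ 2 * (1 + v ^+ 2) ^+ 2 * (1 + v ^+ 2) =
     phi v * (phi v * (1 + v ^+ 2) ^+ 3) by ring.
  by rewrite ler_pM ?gauss_le ?gauss_decay ?mulr_ge0 ?exprn_ge0 ?(ltW p0) ?(ltW v0).
have h0 : 0 <= h u; last by rewrite -subr_ge0; exact: h0.
apply: (@nondecreasing_cvgNy_ge0 R h u _ L) => x y xy _.
apply: (@is_derive_le R h _ x y xy (fun v _ => D v)) => v _.
have v0 := add1sqr_gt0 v; have p0 := gauss_gt0 v.
rewrite mulr_ge0 ?(ltW p0) // -lerBlDl sub0r.
have : `|2 * v * phi v * (1 + v ^+ 2) * (v ^+ 2 - 1)| <= 216; last first.
  by rewrite ler_norml => /andP[].
have -> : 2 * v * phi v * (1 + v ^+ 2) * (v ^+ 2 - 1) =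
  2 * (phi v * ((1 + v ^+ 2) * (v * (v ^+ 2 - 1)))) by ring.
have -> : (216 : R) = 2 * 108 by ring.
rewrite normrM (@ger0_norm _ 2) // ler_pM2l //.
apply: le_trans (gauss_decay v); rewrite normrM (gtr0_norm p0) ler_pM2l //.
rewrite normrM (gtr0_norm v0) exprS ler_pM2l //.
have v2 : v ^+ 2 = `|v| ^+ 2 by rewrite real_normK ?num_real.
have nv : 0 <= `|v| := normr_ge0 v.
rewrite ler_norml; apply/andP; split.
  have : - (`|v| * (1 + v ^+ 2)) <= v * (v ^+ 2 - 1).
    have := ler_norm v; have := lerNnormlW (lexx `|v|); nra.
  nra.
have : v * (v ^+ 2 - 1) <= `|v| * (1 + v ^+ 2).
  have := ler_norm v; have := lerNnormlW (lexx `|v|); nra.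
nra.
Qed.

Lemma gauss_le_sqrt u : phi u * (1 + u ^+ 2) <= 15 * Num.sqrt (q u).
Proof.
have q0 := Phic_gt0 u; have u2 : 0 <= u ^+ 2 by rewrite sqr_ge0.
have l0 : 0 <= phi u * (1 + u ^+ 2).
  by rewrite mulr_ge0 ?ltW ?gauss_gt0 ?add1sqr_gt0.
have r0 : 0 <= 15 * Num.sqrt (q u) by rewrite mulr_ge0 ?sqrtr_ge0.
rewrite -(@ler_pXn2r _ 2) ?nnegrE // [leRHS]exprMn sqr_sqrtr ?(ltW q0) // exprMn.
by have := Phi_lower (- u); rewrite gaussN PhiN sqrrN; lra.
Qed.

Lemma Phic_lt1 u : q u < 1.
Proof. by have := Phi_gt0 u; rewrite /Phic; lra. Qed.

Lemma is_derive_sqrt_Phic u :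
  is_derive u 1 (fun t => Num.sqrt (q t)) (- (phi u / (2 * Num.sqrt (q u)))).
Proof.
have D := is_derive_compf (is_derive1_sqrt (Phic_gt0 u)) (is_derive_Phic u).
by apply: is_derive_conv D _; rewrite mulrC mulNr.
Qed.

Lemma sqrt_Phic_slope u : phi u / (2 * Num.sqrt (q u)) <= 8 / (1 + u ^+ 2).
Proof.
have s0 : 0 < Num.sqrt (q u) by rewrite sqrtr_gt0 Phic_gt0.
have u0 := add1sqr_gt0 u.
rewrite ler_pdivrMr ?mulr_gt0 // mulrAC ler_pdivlMr //.
by have := gauss_le_sqrt u; lra.
Qed.

Lemma Phic_nonincr x y : x <= y -> q y <= q x.
Proof.
move=> xy; rewrite -lerN2.
apply: (@is_derive_le R (fun t => - q t) (fun t => - - phi t) x y xy).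
  by move=> v _; exact: is_derive_oppf (is_derive_Phic v).
by move=> v _; rewrite opprK ltW ?gauss_gt0.
Qed.

Lemma sqrt_Phic_shift u c : 0 <= c ->
  Num.sqrt (q (u - c)) <= Num.sqrt (q u) + 8 * c.
Proof.
move=> c0.
suff : Num.sqrt (q (u - c)) + 8 * (u - c) <= Num.sqrt (q u) + 8 * u by lra.
have cu : u - c <= u by lra.
apply: (@is_derive_le R (fun t => Num.sqrt (q t) + 8 * t)
         (fun t => - (phi t / (2 * Num.sqrt (q t))) + 8) _ _ cu) => v _.
  apply: is_derive_conv (is_derive_addf (is_derive_sqrt_Phic v)
    (is_derive_mulf (is_derive_cstf 8 v) (is_derive_idf v))) _.
  by ring.
have := sqrt_Phic_slope v; have v0 := add1sqr_gt0 v.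
have : 8 / (1 + v ^+ 2) <= 8.
  by rewrite ler_pdivrMr // ler_peMr // lerDl sqr_ge0.
lra.
Qed.

End Gaussian.

(** * Variation of constants for the Stein system *)

Section SteinComparison.
Context {R : realType}.
Variables (p r G : R -> R) (M0 eps delta : R).
Implicit Types v w x : R.
Local Notation phi := (@gauss R).
Local Notation Phi := (@Phi R).
Local Notation q := (@Phic R).

Hypothesis p_ge0 : forall v, 0 <= p v.
Hypothesis p_le1 : forall v, p v <= 1.
Hypothesis p_nonincr : forall v w, v <= w -> p w <= p v.
Hypothesis dr : forall v, is_derive v 1 r (- p v).
Hypothesis dG : forall v, is_derive v 1 G (- (r v + v * p v)).
Hypothesis r_right : forall v, M0 <= v -> r v = 0.
Hypothesis G_right : forall v, M0 <= v -> G v = 0.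
Hypothesis r_left : forall v, v <= - M0 -> r v = - v.
Hypothesis G_left : forall v, v <= - M0 -> G v = 1.
Hypothesis eps_ge0 : 0 <= eps.
Hypothesis delta_ge0 : 0 <= delta.
Hypothesis Stein_bound : forall v, `|p v - G v| <= eps * Num.sqrt (p (v - delta)).

Let A v := Phi v / phi v.
Let B v := q v / phi v.
Let e v := p v - G v.
(** This combination decouples the system: it solves a first-order linear equation with homogeneous
    solution [phi]. For a standard normal variable [r = phi - v q] and [G = q], so that [y = phi]
    and both [I1] and [I2] below vanish. *)
Let y v := r v + v * G v.
(* [I1] and [I2] are the integrals of [A2 e] over ]-oo, v] and of [B2 e] over [v, +oo[
   that appear in variation of constants; the system expresses them through [G] and [y],
   so that derivative comparison replaces integration. *)
Let I1 v := 1 - G v - A v * y v.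
Let I2 v := B v * y v - G v.

Let dA v : is_derive v 1 A (1 + v * A v).
Proof.
have phi0 : phi v != 0 by rewrite gt_eqF ?gauss_gt0.
apply: is_derive_conv (is_derive_mulf (is_derive_Phi v)
  (@is_derive_invf _ phi v _ phi0 (is_derive_gauss v))) _.
by rewrite /A; field.
Qed.

Let dB v : is_derive v 1 B (- 1 + v * B v).
Proof.
have phi0 : phi v != 0 by rewrite gt_eqF ?gauss_gt0.
apply: is_derive_conv (is_derive_mulf (is_derive_Phic v)
  (@is_derive_invf _ phi v _ phi0 (is_derive_gauss v))) _.
by rewrite /B; field.
Qed.

Let dy v : is_derive v 1 y (- v * y v - (1 + v ^+ 2) * e v).
Proof.
apply: is_derive_conv (is_derive_addf (dr v) (is_derive_mulf (is_derive_idf v) (dG v))) _.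
by rewrite /y /e; ring.
Qed.

(** [A2] and [B2] are the second derivatives of [A] and [B]; they are the weights of the error in
    variation of constants, and [Mills2] makes them nonnegative. *)
Let A2 v := v + (1 + v ^+ 2) * A v.
Let B2 v := - v + (1 + v ^+ 2) * B v.

Let dA1 v : is_derive v 1 (fun t => 1 + t * A t) (A2 v).
Proof.
apply: is_derive_conv (is_derive_addf (is_derive_cstf 1 v)
  (is_derive_mulf (is_derive_idf v) (dA v))) _.
by rewrite /A2; ring.
Qed.

Let dB1 v : is_derive v 1 (fun t => - 1 + t * B t) (B2 v).
Proof.
apply: is_derive_conv (is_derive_addf (is_derive_cstf (- 1) v)
  (is_derive_mulf (is_derive_idf v) (dB v))) _.
by rewrite /B2; ring.
Qed.

Let dI1 v : is_derive v 1 I1 (A2 v * e v).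
Proof.
apply: is_derive_conv (is_derive_subf (is_derive_subf (is_derive_cstf 1 v) (dG v))
  (is_derive_mulf (dA v) (dy v))) _.
by rewrite /A2 /e /y; ring.
Qed.

Let dI2 v : is_derive v 1 I2 (- (B2 v * e v)).
Proof.
apply: is_derive_conv (is_derive_subf (is_derive_mulf (dB v) (dy v)) (dG v)) _.
by rewrite /B2 /e /y; ring.
Qed.

Let A2_ge0 v : 0 <= A2 v.
Proof.
have phi0 := gauss_gt0 v.
have -> : A2 v = (v * phi v + (1 + v ^+ 2) * Phi v) / phi v.
  by rewrite /A2 /A; field; rewrite gt_eqF.
by rewrite divr_ge0 ?Mills2 // ltW.
Qed.

Let B2_ge0 v : 0 <= B2 v.
Proof.
have phi0 := gauss_gt0 v.
have -> : B2 v = (- v * phi v + (1 + v ^+ 2) * q v) / phi v.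
  by rewrite /B2 /B; field; rewrite gt_eqF.
rewrite divr_ge0 ?(ltW phi0) //.
by have := Mills2 (- v); rewrite gaussN PhiN sqrrN.
Qed.

Let A1_ge0 v : 0 <= 1 + v * A v.
Proof.
have phi0 := gauss_gt0 v.
have -> : 1 + v * A v = (phi v + v * Phi v) / phi v.
  by rewrite /A; field; rewrite gt_eqF.
by rewrite divr_ge0 ?Phi_Mills // ltW.
Qed.

(** Multiply the Mills bound [v q <= phi] by [Phi] and use [q + Phi = 1]. *)
Let A1_le v : q v * (1 + v * A v) <= 1.
Proof.
have phi0 := gauss_gt0 v.
have -> : q v * (1 + v * A v) = q v * (phi v + v * Phi v) / phi v.
  by rewrite /A; field; rewrite gt_eqF.
rewrite ler_pdivrMr // mul1r.
by have := Phic_Mills v; have := Phi_gt0 v; rewrite /Phic; nra.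
Qed.

Let B1_le0 v : - 1 + v * B v <= 0.
Proof.
have phi0 := gauss_gt0 v.
have -> : - 1 + v * B v = - ((phi v - v * q v) / phi v).
  by rewrite /B; field; rewrite gt_eqF.
by rewrite oppr_le0 divr_ge0 ?subr_ge0 ?Phic_Mills // ltW.
Qed.

Let B1_le v : Phi v * (1 - v * B v) <= 1.
Proof.
have phi0 := gauss_gt0 v.
have -> : Phi v * (1 - v * B v) = Phi v * (phi v - v * q v) / phi v.
  by rewrite /B; field; rewrite gt_eqF.
rewrite ler_pdivrMr // mul1r.
by have := Phi_Mills v; have := Phic_gt0 v; rewrite /Phic; nra.
Qed.

(** Since [q A = Phi B], the terms in [y] cancel in this combination of [I1] and [I2]. *)
Let representation v : G v - q v = - (q v * I1 v + Phi v * I2 v).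
Proof. by rewrite /I1 /I2 /A /B /Phic; field; rewrite gt_eqF ?gauss_gt0. Qed.

Section OneStep.
Variable D : R.
Hypothesis sqrt_close : forall v, `|Num.sqrt (p v) - Num.sqrt (q v)| <= D.
Let D' := D + 8 * delta.

Let D_ge0 : 0 <= D'.
Proof.
have := sqrt_close 0; have := normr_ge0 (Num.sqrt (p 0) - Num.sqrt (q 0)).
by rewrite /D'; have := delta_ge0; lra.
Qed.

Let sqrt_p_shift v : Num.sqrt (p (v - delta)) <= Num.sqrt (q v) + D'.
Proof.
have := sqrt_Phic_shift v delta_ge0; have := sqrt_close (v - delta).
by rewrite ler_norml /D' => /andP[_]; lra.
Qed.

(* A majorant of [I1]: as [q A' <= 1], its derivative exceeds [A2 |e|]. *)
Let H v := eps * ((1 + v * A v) * (Num.sqrt (q v) + D') + (Num.sqrt (q v))^-1).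

Let H_ge0 v : 0 <= H v.
Proof.
rewrite mulr_ge0 // addr_ge0 ?invr_ge0 ?sqrtr_ge0 // mulr_ge0 //.
by rewrite addr_ge0 ?sqrtr_ge0.
Qed.

(** Differentiating the decreasing factor [sqrt q] costs [(1 + v A) phi / (2 sqrt q)]; the summand
    [(sqrt q)^-1] of [H] was added to pay for it. The last bracket is what remains, nonnegative by
    [A1_le]. *)
Let H' v := eps * (A2 v * (Num.sqrt (q v) + D') +
  phi v / (2 * Num.sqrt (q v) * q v) * (1 - q v * (1 + v * A v))).

Let dH v : is_derive v 1 H (H' v).
Proof.
have s0 : Num.sqrt (q v) != 0 by rewrite gt_eqF // sqrtr_gt0 Phic_gt0.
apply: is_derive_conv (is_derive_mulf (is_derive_cstf eps v) (is_derive_addf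
  (is_derive_mulf (dA1 v) (is_derive_addf (is_derive_sqrt_Phic v) (is_derive_cstf D' v)))
  (@is_derive_invf _ (fun t => Num.sqrt (q t)) v _ s0 (is_derive_sqrt_Phic v)))) _.
have := sqr_sqrtr (ltW (Phic_gt0 v)); rewrite /H'.
by move: (Num.sqrt _) s0 => t t0 <-; field.
Qed.

Let H'_ge v : A2 v * `|e v| <= H' v.
Proof.
apply: le_trans (_ : eps * (A2 v * (Num.sqrt (q v) + D')) <= _).
  rewrite mulrCA ler_wpM2l //; apply: le_trans (Stein_bound v) _.
  exact: ler_wpM2l.
rewrite ler_wpM2l // lerDl mulr_ge0 ?subr_ge0 //.
by rewrite divr_ge0 ?mulr_ge0 ?sqrtr_ge0 ?(ltW (gauss_gt0 _)) ?(ltW (Phic_gt0 _)).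
Qed.

Let I1_le v : `|I1 v| <= H v.
Proof.
(* To the left of [- M0] the boundary values give [y = 0] and [G = 1], so [I1] vanishes; from there
   [H - I1] and [H + I1] can only increase. *)
pose w := Num.min v (- M0).
have wv : w <= v by rewrite ge_min lexx.
have wM : w <= - M0 by rewrite ge_min lexx orbT.
have I1w : I1 w = 0 by rewrite /I1 /y r_left // G_left //; ring.
have := H_ge0 w => Hw.
have inc1 : H w - I1 w <= H v - I1 v.
  apply: (@is_derive_le R (fun t => H t - I1 t) (fun t => H' t - A2 t * e t) _ _ wv) => x _.
    exact: is_derive_subf (dH x) (dI1 x).
  rewrite subr_ge0; apply: le_trans (H'_ge x); rewrite ler_wpM2l //.
  exact: ler_norm.
have inc2 : H w + I1 w <= H v + I1 v.
  apply: (@is_derive_le R (fun t => H t + I1 t) (fun t => H' t + A2 t * e t) _ _ wv) => x _.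
    exact: is_derive_addf (dH x) (dI1 x).
  rewrite -lerBlDr sub0r -mulrN; apply: le_trans (H'_ge x); rewrite ler_wpM2l //.
  by rewrite -normrN ler_norm.
by rewrite ler_norml; lra.
Qed.

(** To the right of [v] the bound on the error is largest at [v], because [p] decreases. A constant
    [K] therefore majorizes [e], and [B2] has the explicit antiderivative [- 1 + x B x], which is
    nonpositive. In contrast to [I1_le], [D] does not enter. *)
Let I2_le v : `|I2 v| <= eps * Num.sqrt (p (v - delta)) * (1 - v * B v).
Proof.
pose w := Num.max v M0.
have vw : v <= w by rewrite le_max lexx.
have wM : M0 <= w by rewrite le_max lexx orbT.
have I2w : I2 w = 0 by rewrite /I2 /y r_right // G_right //; ring.
pose K := eps * Num.sqrt (p (v - delta)).
have K0 : 0 <= K by rewrite mulr_ge0 ?sqrtr_ge0.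
have eK x : v <= x -> `|e x| <= K.
  move=> vx; apply: le_trans (Stein_bound x) _; rewrite ler_wpM2l // ler_wsqrtr //.
  by apply: p_nonincr; rewrite lerB.
have Bw : K * (- 1 + w * B w) <= 0 by rewrite mulr_ge0_le0.
have inc1 : K * (- 1 + v * B v) + I2 v <= K * (- 1 + w * B w) + I2 w.
  apply: (@is_derive_le R (fun t => K * (- 1 + t * B t) + I2 t)
    (fun t => B2 t * (K - e t)) _ _ vw) => x /andP[vx _].
    apply: is_derive_conv (is_derive_addf (is_derive_mulf (is_derive_cstf K x) (dB1 x)) (dI2 x)) _.
    by ring.
  by rewrite mulr_ge0 // subr_ge0 (le_trans _ (eK x vx)) // ler_norm.
have inc2 : K * (- 1 + v * B v) - I2 v <= K * (- 1 + w * B w) - I2 w.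
  apply: (@is_derive_le R (fun t => K * (- 1 + t * B t) - I2 t)
    (fun t => B2 t * (K + e t)) _ _ vw) => x /andP[vx _].
    apply: is_derive_conv (is_derive_subf (is_derive_mulf (is_derive_cstf K x) (dB1 x)) (dI2 x)) _.
    by ring.
  rewrite mulr_ge0 // -lerBlDr sub0r (le_trans _ (eK x vx)) //.
  by rewrite -normrN ler_norm.
by rewrite ler_norml -/K; lra.
Qed.

(** The coefficients add up over three terms: [e] and [Phi I2] each contribute [sqrt q + D'], and
    [q I1] contributes [2 sqrt q + D']. *)
Let p_close v : `|p v - q v| <= eps * (4 * Num.sqrt (q v) + 3 * D').
Proof.
have -> : p v - q v = e v - q v * I1 v - Phi v * I2 v.
  by have := representation v; rewrite /e; lra.
have q0 := Phic_gt0 v; have P0 := Phi_gt0 v.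
have s0 : 0 < Num.sqrt (q v) by rewrite sqrtr_gt0.
have qI : `|q v * I1 v| <= eps * (2 * Num.sqrt (q v) + D').
  rewrite normrM (gtr0_norm q0); apply: le_trans (ler_wpM2l (ltW q0) (I1_le v)) _.
  rewrite /H mulrCA ler_wpM2l // mulrDr mulrA.
  have -> : q v / Num.sqrt (q v) = Num.sqrt (q v).
    by rewrite -{1}(sqr_sqrtr (ltW q0)) expr2 mulfK ?gt_eqF.
  have : q v * (1 + v * A v) * (Num.sqrt (q v) + D') <= Num.sqrt (q v) + D'.
    by rewrite ler_piMl // addr_ge0 // ltW.
  lra.
have PI : `|Phi v * I2 v| <= eps * Num.sqrt (p (v - delta)).
  rewrite normrM (gtr0_norm P0); apply: le_trans (ler_wpM2l (ltW P0) (I2_le v)) _.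
  by rewrite mulrCA ler_piMr // mulr_ge0 ?sqrtr_ge0.
have shift : eps * Num.sqrt (p (v - delta)) <= eps * (Num.sqrt (q v) + D').
  exact: ler_wpM2l.
have := ler_normB (e v - q v * I1 v) (Phi v * I2 v).
have := ler_normB (e v) (q v * I1 v).
have := Stein_bound v; rewrite -/(e v).
lra.
Qed.

(** Let [d] be the gap of the roots and [N] their sum, so [d <= N] and
    [d N <= eps (4 sqrt q + 3 D')]. If [d > 8 eps + D' / 4], then [d N >= 8 eps N + d D' / 4]. Half
    of [8 eps N] covers [4 eps sqrt q], while the other half, bounded below by [4 eps d], and
    [d D' / 4] together exceed [3 eps D'], a contradiction. *)
Lemma sqrt_close_step v :
  `|Num.sqrt (p v) - Num.sqrt (q v)| <= 8 * eps + (D + 8 * delta) / 4.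
Proof.
have := p_close v; rewrite -/D'.
have Pq : Num.sqrt (p v) ^+ 2 = p v by rewrite sqr_sqrtr.
have Qq : Num.sqrt (q v) ^+ 2 = q v by rewrite sqr_sqrtr ?(ltW (Phic_gt0 v)).
rewrite -{1}Pq -{1}Qq; move: (sqrtr_ge0 (p v)) (sqrtr_ge0 (q v)).
move: (Num.sqrt (p v)) (Num.sqrt (q v)) {Pq Qq} => x z x0 z0.
have -> : x ^+ 2 - z ^+ 2 = (x - z) * (x + z) by ring.
rewrite normrM (ger0_norm (addr_ge0 x0 z0)) => xz; rewrite leNgt; apply/negP.
have dxz : `|x - z| <= x + z by rewrite ler_norml; lra.
move: `|x - z| xz dxz => d; move: D_ge0 eps_ge0 z0; rewrite -/D'; nra.
Qed.

End OneStep.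

Lemma Stein_comparison v : `|Num.sqrt (p v) - Num.sqrt (q v)| <= 12 * eps + 3 * delta.
Proof.
pose E := [set `|Num.sqrt (p v) - Num.sqrt (q v)| | v in [set: R]].
have E0 : E !=set0 by exists `|Num.sqrt (p 0) - Num.sqrt (q 0)|; exists 0.
have Eub : has_ubound E.
  exists 1 => _ [w _ <-].
  have s1 x : 0 <= x -> x <= 1 -> 0 <= Num.sqrt x <= 1.
    by move=> x0 x1; rewrite sqrtr_ge0 -sqrtr1 ler_wsqrtr.
  have := s1 _ (p_ge0 w) (p_le1 w).
  have := s1 _ (ltW (Phic_gt0 w)) (ltW (Phic_lt1 w)).
  by rewrite ler_norml; lra.
have Esup w : `|Num.sqrt (p w) - Num.sqrt (q w)| <= sup E.
  by apply: (ub_le_sup Eub); exists w.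
(* The supremum is finite as both roots lie in [[0, 1]], so it may be moved to the left:
   [sup E <= (32 eps + 8 delta) / 3], rounded up to integer coefficients. *)
have : sup E <= 8 * eps + (sup E + 8 * delta) / 4.
  by apply: ge_sup => // _ [w _ <-]; exact: sqrt_close_step.
by have := Esup v; have := eps_ge0; have := delta_ge0; lra.
Qed.

End SteinComparison.

(** * Smooth compactly supported test functions *)

(** Serves both the flat functions, through their decay at 0, and the functionals [r] and [G], where
    concentration turns a first-order error into a second-order one. *)
Lemma is_derive_quadratic_error {R : realType} (f : R -> R) (x a C : R) :
  (forall h, `|f (x + h) - f x - h * a| <= C * h ^+ 2) -> is_derive x 1 f a.
Proof.
move=> fC.
have L : h^-1 *: (f (h *: 1 + x) - f x) @[h --> 0^'] --> a.
  apply/cvgrPdist_le => e e0; near=> h.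
  have h0 : h != 0 by near: h; exact: nbhs_dnbhs_neq.
  have C1 : 0 < `|C| + 1 by rewrite ltr_wpDl.
  have hC : `|h| <= e / (`|C| + 1).
    near: h; apply: dnbhs0_le; exact: divr_gt0.
  rewrite -[h *: 1]/(h * 1) mulr1 -[_ *: _]/(_ * _) (addrC h) distrC.
  have -> : h^-1 * (f (x + h) - f x) - a = h^-1 * (f (x + h) - f x - h * a).
    by field.
  rewrite normrM normfV ler_pdivrMl ?normr_gt0 //; apply: le_trans (fC h) _.
  rewrite -real_normK ?num_real // expr2 mulrA mulrC ler_wpM2l //.
  apply: le_trans (_ : (`|C| + 1) * `|h| <= _); last first.
    by rewrite mulrC -ler_pdivlMr.
  by rewrite ler_wpM2r // (le_trans (ler_norm C)) // lerDl.
split; first by apply/cvg_ex; exists a.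
exact: cvg_lim L.
Unshelve. all: by end_near. Qed.

Section FlatFunctions.
Context {R : realType}.
Implicit Types (P Q : {poly R}) (x t : R).

(** The functions [P(1/x) exp (-1/x)], extended by 0, form a family closed under differentiation;
    the polynomial records the derivative reached. The case [P = 1] is the classical smooth function
    that vanishes on the negative half-line. *)
Definition flat P x : R := if 0 < x then P.[x^-1] * expR (- x^-1) else 0.

Lemma poly_expR_bounded P : exists2 C, 0 <= C &
  forall t, 0 <= t -> `|P.[t] * expR (- t)| <= C.
Proof.
have expX n t : 0 <= t -> t ^+ n * expR (- t) <= n`!%:R.
  move=> t0; rewrite expRN ler_pdivrMr ?expR_gt0 //.
  case: n => [|n].
    by rewrite expr0 fact0 mul1r; have := expR_ge1Dx t; lra.
  rewrite -ler_pdivrMl ?ltr0n ?fact_gt0 // mulrC.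
  by apply: le_trans (expR_ge1Dxn n t0); rewrite lerDr.
exists (\sum_(i < size P) `|P`_i| * i`!%:R).
  by apply: sumr_ge0 => i _; rewrite mulr_ge0.
move=> t t0; rewrite horner_coef mulr_suml (le_trans (ler_norm_sum _ _ _)) //.
apply: ler_sum => i _; rewrite -mulrA normrM ler_wpM2l //.
by rewrite ger0_norm ?expX // mulr_ge0 ?exprn_ge0 ?expR_ge0.
Qed.

Lemma flat_bounded P : exists2 C, 0 <= C & forall x, `|flat P x| <= C.
Proof.
have [C C0 PC] := poly_expR_bounded P; exists C => // x.
rewrite /flat; case: ltP => x0; last by rewrite normr0.
by apply: PC; rewrite invr_ge0 ltW.
Qed.

Definition flat_deriv P : {poly R} := 'X ^+ 2 * (P - P^`()).

Lemma is_derive_flat P x : is_derive x 1 (flat P) (flat (flat_deriv P) x).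
Proof.
have [x0|x0|->] := ltgtP x 0.
- have [C C0 PC] := flat_bounded P.
  apply: (@is_derive_quadratic_error R _ x _ (C / x ^+ 2)) => h.
  have flat0 Q y : y <= 0 -> flat Q y = 0 by rewrite /flat ltNge => ->.
  rewrite !(flat0 _ x) ?(ltW x0) // mulr0 !subr0.
  have [xh|xh] := ltP 0 (x + h); last first.
    by rewrite flat0 // normr0 mulr_ge0 ?sqr_ge0 ?divr_ge0 ?sqr_ge0.
  (* A step from [x < 0] to a positive point has [|h| > |x|], so the uniform bound [C] is already
     below [C h^2 / x^2]. *)
  rewrite -mulrA mulrC; have := PC (x + h); move/le_trans; apply.
  have x2 : 0 < x ^+ 2 by rewrite exprn_even_gt0 //= lt_eqF.
  by rewrite ler_peMl // mulrC ler_pdivlMr // mul1r; nra.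
- have x1 : x != 0 by rewrite gt_eqF.
  apply: (@near_eq_is_derive _ _ _ (fun t : R => P.[t^-1] * expR (- t^-1))).
    near=> t; rewrite /flat ifT //; near: t; exact: lt_nbhsr.
  have dV := @is_derive_invf _ id x _ x1 (is_derive_idf x).
  apply: is_derive_conv (is_derive_mulf (is_derive_compf (is_derive_poly P _) dV)
    (is_derive_compf (is_derive_expR _) (is_derive_oppf dV))) _.
  by rewrite /flat x0 /flat_deriv !hornerE /= exprVn; ring.
(* Two spare powers of [1/h] inside the polynomial become the factor [h^2] of the quadratic error at
   0. *)
have [C C0 PC] := flat_bounded ('X ^+ 2 * P).
apply: (@is_derive_quadratic_error R _ 0 _ C) => h.
rewrite /flat ltxx add0r mulr0 !subr0.
case: ltP => h0; last by rewrite normr0 mulr_ge0 ?sqr_ge0.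
have h2 : 0 < h ^+ 2 by rewrite exprn_gt0.
have := PC h; rewrite /flat h0.
have -> : ('X ^+ 2 * P).[h^-1] * expR (- h^-1) = P.[h^-1] * expR (- h^-1) / h ^+ 2.
  by rewrite !hornerE exprVn; ring.
by rewrite normrM normfV (gtr0_norm h2) ler_pdivrMr.
Unshelve. all: by end_near. Qed.

(** A class containing the test functions and stable under differentiation: the product rule calls
    for sums, and the inner slopes [c1], [c2] are absorbed into the polynomials. Smoothness then
    follows by induction on the order. *)
Inductive flat_sums (c1 d1 c2 d2 : R) : (R -> R) -> Prop :=
| flat_prod P Q : flat_sums c1 d1 c2 d2
    (fun x => flat P (c1 * x + d1) * flat Q (c2 * x + d2))
| flat_add f g : flat_sums c1 d1 c2 d2 f -> flat_sums c1 d1 c2 d2 g ->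
    flat_sums c1 d1 c2 d2 (fun x => f x + g x).

Lemma flatZ c P x : flat (c *: P) x = c * flat P x.
Proof. by rewrite /flat; case: ifP => _; rewrite ?mulr0 // hornerZ mulrA. Qed.

Lemma flat_sums_derive c1 d1 c2 d2 f : flat_sums c1 d1 c2 d2 f ->
  exists2 f', flat_sums c1 d1 c2 d2 f' & forall x, is_derive x 1 f (f' x).
Proof.
elim=> [P Q|f1 f2 _ [g1 fg1 d1f] _ [g2 fg2 d2f]]; last first.
  exists (fun x => g1 x + g2 x); first exact: flat_add.
  by move=> x; exact: is_derive_addf.
exists (fun x => flat (c1 *: flat_deriv P) (c1 * x + d1) * flat Q (c2 * x + d2) +
  flat P (c1 * x + d1) * flat (c2 *: flat_deriv Q) (c2 * x + d2)).
  by apply: flat_add; exact: flat_prod.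
move=> x.
have aff c d : is_derive x 1 (fun t => c * t + d) c.
  apply: is_derive_conv (is_derive_addf (is_derive_mulf (is_derive_cstf c x)
    (is_derive_idf x)) (is_derive_cstf d x)) _.
  by ring.
apply: is_derive_conv (is_derive_mulf
  (is_derive_compf (is_derive_flat P _) (aff c1 d1))
  (is_derive_compf (is_derive_flat Q _) (aff c2 d2))) _.
by rewrite !flatZ; ring.
Qed.

Lemma flat_sums_smooth c1 d1 c2 d2 f : flat_sums c1 d1 c2 d2 f ->
  forall k x, derivable (f^`(k))%classic x 1.
Proof.
move=> ff k; suff [g fg dg] : exists2 g, flat_sums c1 d1 c2 d2 g &
    forall x, is_derive x 1 ((f^`(k))%classic) (g x).
  by move=> x; case: (dg x).
elim: k => [|k [g fg dg]]; first by rewrite derive1n0; exact: flat_sums_derive.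
rewrite derive1nS; have -> : ((f^`(k))^`())%classic = g.
  by apply/funext => x; rewrite derive1E; case: (dg x).
exact: flat_sums_derive.
Qed.

(* A smooth step from [v] on the scale [h], cut off below [M] on the much larger scale [L]. *)
Definition testfun (v h M L x : R) : R := flat 1 ((x - v) / h) * flat 1 ((M - x) / L).

Lemma testfun_Cc v h M L : 0 < h -> 0 < L -> Cc_infty (testfun v h M L).
Proof.
move=> h0 L0; split.
  have -> : testfun v h M L = (fun x => flat 1 (h^-1 * x + - v / h) *
      flat 1 (- L^-1 * x + M / L)).
    by apply/funext => x; congr (flat _ _ * flat _ _); ring.
  exact: flat_sums_smooth (flat_prod _ _ _ _ _ _).
apply: (subclosed_compact _ (@segment_compact _ v M)); first exact: closed_closure.
rewrite [X in _ `<=` X](closure_id _).1; last exact: interval_closed.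
apply: closure_subset => x /=; rewrite in_itv /= /testfun /flat.
case: ifP => [|_]; last by rewrite mul0r eqxx.
rewrite pmulr_lgt0 ?invr_gt0 // subr_gt0 => vx.
case: ifP => [|_]; last by rewrite mulr0 eqxx.
by rewrite pmulr_lgt0 ?invr_gt0 // subr_gt0 => xM _; rewrite !ltW.
Qed.

Definition flat1' := flat ('X ^+ 2).

Lemma is_derive_flat1 x : is_derive x 1 (flat 1) (flat1' x).
Proof.
by have := is_derive_flat 1 x; rewrite /flat_deriv derivC subr0 mulr1.
Qed.

Lemma flat1_ge0 x : 0 <= flat 1 x.
Proof. by rewrite /flat; case: ifP => // _; rewrite hornerC mul1r expR_ge0. Qed.

Lemma flat1_le1 x : flat 1 x <= 1.
Proof.
rewrite /flat; case: ifP => // x0; rewrite hornerC mul1r -expR0 ler_expR.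
by rewrite oppr_le0 invr_ge0 ltW.
Qed.

Lemma flat1_le0 x : x <= 0 -> flat 1 x = 0.
Proof. by rewrite /flat ltNge => ->. Qed.

Lemma flat1_ge x : 1 <= x -> expR (- 1) <= flat 1 x.
Proof.
move=> x1; rewrite /flat ifT ?(lt_le_trans _ x1) // hornerC mul1r ler_expR lerN2.
by rewrite invf_le1 // (lt_le_trans _ x1).
Qed.

Lemma flat1'_ge0 x : 0 <= flat1' x.
Proof.
rewrite /flat1' /flat; case: ifP => // _.
by rewrite hornerXn mulr_ge0 ?sqr_ge0 ?expR_ge0.
Qed.

Lemma flat1'_le x : flat1' x <= 2.
Proof.
rewrite /flat1' /flat; case: ifP => // x0; rewrite hornerXn expRN.
have y0 : 0 <= x^-1 by rewrite invr_ge0 ltW.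
rewrite ler_pdivrMr ?expR_gt0 //.
by have := expR_ge1Dxn 1 y0; rewrite /= (_ : 2`!%:R = 2) //; lra.
Qed.

Lemma flat1'_ge x : 1 <= x <= 2 -> expR (- 1) / 4 <= flat1' x.
Proof.
move=> /andP[x1 x2]; have x0 : 0 < x := lt_le_trans ltr01 x1.
rewrite /flat1' /flat x0 hornerXn mulrC ler_pM ?expR_ge0 ?invr_ge0 //.
  by rewrite exprVn lef_pV2 ?posrE ?exprn_gt0 //; nra.
by rewrite ler_expR lerN2 invf_le1.
Qed.

Definition testfun' (v h M L x : R) : R := flat1' ((x - v) / h) / h * flat 1 ((M - x) / L)
  - flat 1 ((x - v) / h) * (flat1' ((M - x) / L) / L).

Lemma is_derive_testfun v h M L x : is_derive x 1 (testfun v h M L) (testfun' v h M L x).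
Proof.
have d1 : is_derive x 1 (fun t => (t - v) / h) h^-1.
  apply: is_derive_conv (is_derive_mulf (is_derive_subf (is_derive_idf x)
    (is_derive_cstf v x)) (is_derive_cstf h^-1 x)) _.
  by ring.
have d2 : is_derive x 1 (fun t => (M - t) / L) (- L^-1).
  apply: is_derive_conv (is_derive_mulf (is_derive_subf (is_derive_cstf M x)
    (is_derive_idf x)) (is_derive_cstf L^-1 x)) _.
  by ring.
apply: is_derive_conv (is_derive_mulf (is_derive_compf (is_derive_flat1 _) d1)
  (is_derive_compf (is_derive_flat1 _) d2)) _.
by rewrite /testfun'; ring.
Qed.

Lemma testfun_ge0 v h M L x : 0 <= testfun v h M L x.
Proof. by rewrite mulr_ge0 ?flat1_ge0. Qed.

Lemma testfun_le1 v h M L x : testfun v h M L x <= 1.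
Proof. by rewrite mulr_ile1 ?flat1_ge0 ?flat1_le1. Qed.

Lemma testfun_le v h M L x : 0 < h -> testfun v h M L x <= (v < x)%R%:R.
Proof.
move=> h0; case: ltP => vx; first exact: testfun_le1.
by rewrite /testfun flat1_le0 ?mul0r // pmulr_lle0 ?invr_gt0 // subr_le0.
Qed.

Lemma testfun_shift v h M L x y :
  testfun v h M L (x + y) = testfun (v - y) h (M - y) L x.
Proof.
by rewrite /testfun; congr (flat _ (_ / _) * flat _ (_ / _)); ring.
Qed.

Lemma testfun'_shift v h M L x y :
  testfun' v h M L (x + y) = testfun' (v - y) h (M - y) L x.
Proof.
rewrite /testfun' (_ : x + y - v = x - (v - y)); last by ring.
by rewrite (_ : M - (x + y) = M - y - x) //; ring.
Qed.

(* Positive on the transition zone; beyond it only the slow cutoff contributes. *)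
Lemma testfun'_ge v h M L x : 0 < h -> 0 < L -> x + L <= M ->
  expR (- 2) / (4 * h) * (v + h < x <= v + 2 * h)%R%:R - 2 / L * (v < x)%R%:R
    <= testfun' v h M L x.
Proof.
move=> h0 L0 xM; rewrite /testfun' lerD //; last first.
  rewrite lerN2; case: ltP => vx; last first.
    by rewrite mulr0 flat1_le0 ?mul0r // pmulr_lle0 ?invr_gt0 // subr_le0.
  rewrite mulr1 -[leRHS]mul1r ler_pM ?flat1_ge0 ?flat1_le1 //.
    by rewrite divr_ge0 ?flat1'_ge0 // ltW.
  by rewrite ler_pM2r ?invr_gt0 ?flat1'_le.
have xL : 1 <= (M - x) / L by rewrite ler_pdivlMr // mul1r; lra.
have [/andP[x1 x2]|_] := boolP (v + h < x <= v + 2 * h); last first.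
  by rewrite mulr0 !mulr_ge0 ?flat1'_ge0 ?flat1_ge0 ?invr_ge0 ?ltW.
(* [exp (-1) / 4] bounds [flat1'] from below on [[1, 2]], and the second [exp (-1)] bounds the slow
   cutoff, whose argument is still at least 1. *)
have -> : expR (- 2) / (4 * h) * 1%:R = expR (- 1) / 4 / h * expR (- 1) :> R.
  have -> : (- 2 = - 1 + - 1 :> R) by ring.
  by rewrite expRD; field; rewrite gt_eqF.
have xh : 1 <= (x - v) / h <= 2.
  by rewrite ler_pdivlMr // ler_pdivrMr //; apply/andP; split; lra.
rewrite ler_pM ?flat1_ge ?expR_ge0 //.
  by rewrite !divr_ge0 ?expR_ge0 // ltW.
by rewrite ler_pM2r ?invr_gt0 ?flat1'_ge.
Qed.

Lemma testfun'_bounded v h M L x : 0 < h -> 0 < L ->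
  `|testfun' v h M L x| <= 2 / h + 2 / L.
Proof.
move=> h0 L0; apply: le_trans (ler_normB _ _) _; rewrite !normrM !normfV.
rewrite !(ger0_norm (flat1'_ge0 _)) !(ger0_norm (flat1_ge0 _)) !gtr0_norm //.
rewrite lerD //.
  rewrite -[leRHS]mulr1 ler_pM ?flat1_ge0 ?flat1_le1 ?divr_ge0 ?flat1'_ge0 ?(ltW h0) //.
  by rewrite ler_pM2r ?invr_gt0 ?flat1'_le.
rewrite -[leRHS]mul1r ler_pM ?flat1_ge0 ?flat1_le1 ?divr_ge0 ?flat1'_ge0 ?(ltW L0) //.
by rewrite ler_pM2r ?invr_gt0 ?flat1'_le.
Qed.

Lemma measurable_testfun v h M L : measurable_fun setT (testfun v h M L).
Proof.
apply: continuous_measurable_fun => x.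
exact: is_derive_continuous (is_derive_testfun v h M L x).
Qed.

End FlatFunctions.

(** * Expectation and independence *)

Section RealExpectation.
Context d (T : measurableType d) (R : realType) (P : probability T R).
Implicit Types (f g : T -> R) (A : set T).

Definition intg f : Prop := P.-integrable setT (EFin \o f).
Definition Ex f : R := \int[P]_x f x.

Lemma ExE f : Ex f = fine 'E_P[f].
Proof. by rewrite unlock. Qed.

Lemma intg_measurable f : intg f -> measurable_fun setT f.
Proof. by move=> /integrableP[/measurable_EFinP]. Qed.

Lemma intg_dom f g : measurable_fun setT f -> (forall x, `|f x| <= g x) ->
  intg g -> intg f.
Proof.
move=> mf fg ig; apply: le_integrable ig => //; first exact/measurable_EFinP.
by move=> x _ /=; rewrite lee_fin (le_trans (fg x)) // ler_norm.
Qed.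

Lemma intg_cst c : intg (fun=> c).
Proof.
exact: finite_measure_integrable_cst.
Qed.

Lemma intg_bounded f C : measurable_fun setT f -> (forall x, `|f x| <= C) -> intg f.
Proof. by move=> mf fC; apply: intg_dom mf fC (intg_cst C). Qed.

Lemma intgD f g : intg f -> intg g -> intg (fun x => f x + g x).
Proof. by move=> If Ig; have := integrableD measurableT If Ig. Qed.

Lemma intgB f g : intg f -> intg g -> intg (fun x => f x - g x).
Proof. by move=> If Ig; have := integrableB measurableT If Ig. Qed.

Lemma intgZ c f : intg f -> intg (fun x => c * f x).
Proof. by move=> If; have := integrableZl measurableT c If. Qed.

Lemma intg_sum (I : Type) (s : seq I) (F : I -> T -> R) :
  (forall i, intg (F i)) -> intg (fun x => \sum_(i <- s) F i x).
Proof.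
move=> IF; elim: s => [|i s IH].
  by under eq_fun do rewrite big_nil; exact: intg_cst.
by under eq_fun do rewrite big_cons; exact: intgD.
Qed.

Lemma intg_norm f : intg f -> intg (fun x => `|f x|).
Proof.
move=> If; have := integrable_abse If.
by [].
Qed.

Lemma ExD f g : intg f -> intg g -> Ex (fun x => f x + g x) = Ex f + Ex g.
Proof. exact: RintegralD. Qed.

Lemma ExB f g : intg f -> intg g -> Ex (fun x => f x - g x) = Ex f - Ex g.
Proof. exact: RintegralB. Qed.

Lemma ExZ c f : intg f -> Ex (fun x => c * f x) = c * Ex f.
Proof. exact: RintegralZl. Qed.

Lemma Ex_cst c : Ex (fun=> c) = c.
Proof.
rewrite /Ex Rintegral_cst //; have /= -> := probability_setT P.
by rewrite mulr1.
Qed.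

Lemma Ex_sum (I : Type) (s : seq I) (F : I -> T -> R) :
  (forall i, intg (F i)) ->
  Ex (fun x => \sum_(i <- s) F i x) = \sum_(i <- s) Ex (F i).
Proof.
move=> IF; elim: s => [|i s IH].
  by under [in LHS]eq_fun do rewrite big_nil; rewrite big_nil Ex_cst.
under [in LHS]eq_fun do rewrite big_cons.
by rewrite big_cons ExD ?IH //; exact: intg_sum.
Qed.

Lemma Ex_le f g : intg f -> intg g -> (forall x, f x <= g x) -> Ex f <= Ex g.
Proof. by move=> If Ig fg; apply: le_Rintegral => // x _. Qed.

Lemma Ex_ge0 f : (forall x, 0 <= f x) -> 0 <= Ex f.
Proof. by move=> f0; apply: Rintegral_ge0 => x _. Qed.

Lemma Ex_norm f : intg f -> `|Ex f| <= Ex (fun x => `|f x|).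
Proof. by move=> If; exact: le_normr_Rintegral. Qed.

Definition pr A : R := fine (P A).

Lemma indic_pred (b : T -> bool) x : \1_[set x | b x] x = (b x)%:R :> R.
Proof.
by rewrite indicE; congr ((nat_of_bool _)%:R); apply/idP/idP; rewrite inE.
Qed.

Lemma Ex_pr (b : T -> bool) : measurable [set x | b x] ->
  Ex (fun x => (b x)%:R) = pr [set x | b x].
Proof.
move=> mb; rewrite /Ex /Rintegral /pr.
have -> : (fun x => ((b x)%:R)%:E) = (fun x => (\1_[set x | b x] x : R)%:E).
  by apply/funext => x; rewrite indic_pred.
by rewrite integral_indic // setIT.
Qed.

Lemma intg_pred (b : T -> bool) : measurable [set x | b x] ->
  intg (fun x => (b x)%:R).
Proof.
move=> mb; apply: (@intg_bounded _ 1) => [|x]; last first.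
  by case: (b x); rewrite ?normr0 ?normr1.
have -> : (fun x => (b x)%:R) = \1_[set x | b x] :> (T -> R).
  by apply/funext => x; rewrite indic_pred.
exact: measurable_indic.
Qed.

Lemma pr_ge0 A : 0 <= pr A.
Proof. exact: fine_ge0. Qed.

Lemma pr_le A B : measurable A -> measurable B -> A `<=` B -> pr A <= pr B.
Proof.
move=> mA mB AB; rewrite fine_le ?fin_num_measure //.
by rewrite le_measure ?inE.
Qed.

Lemma pr_le1 A : measurable A -> pr A <= 1.
Proof.
move=> mA; rewrite -[leRHS]/(fine 1%E) fine_le ?fin_num_measure //.
exact: probability_le1.
Qed.

Lemma quadratic_ge0 (a b c : R) : 0 <= c ->
  (forall t, 0 <= a - 2 * t * b + t ^+ 2 * c) -> b ^+ 2 <= a * c.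
Proof.
rewrite le_eqVlt => /predU1P[<- abc|c0 abc]; last first.
  have := abc (b / c); rewrite -(@ler_pM2r _ c) // mul0r.
  have -> : (a - 2 * (b / c) * b + (b / c) ^+ 2 * c) * c = a * c - b ^+ 2.
    by field; rewrite gt_eqF.
  by rewrite subr_ge0.
have [->|b0] := eqVneq b 0; first by rewrite expr0n mulr0.
(* For [c = 0] the expression is affine in [t]; this [t] gives it the value [- 1] unless [b = 0]. *)
have := abc ((a + 1) / (2 * b)).
have -> : a - 2 * ((a + 1) / (2 * b)) * b + ((a + 1) / (2 * b)) ^+ 2 * 0 = -1.
  by field.
lra.
Qed.

Lemma intgM_L2 f g : measurable_fun setT f -> measurable_fun setT g ->
  intg (fun x => f x ^+ 2) -> intg (fun x => g x ^+ 2) ->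
  intg (fun x => f x * g x).
Proof.
move=> mf mg If Ig; apply: (intg_dom _ _ (intgD If Ig)) => [|x].
  exact: measurable_funM.
have : 0 <= `|f x| ^+ 2 + `|g x| ^+ 2 - 2 * (`|f x| * `|g x|).
  have -> : `|f x| ^+ 2 + `|g x| ^+ 2 - 2 * (`|f x| * `|g x|) =
    (`|f x| - `|g x|) ^+ 2 by ring.
  exact: sqr_ge0.
rewrite !real_normK ?num_real // normrM; have := normr_ge0 (f x).
have := normr_ge0 (g x); nra.
Qed.

Lemma Cauchy_Schwarz f g : measurable_fun setT f -> measurable_fun setT g ->
  intg (fun x => f x ^+ 2) -> intg (fun x => g x ^+ 2) ->
  `|Ex (fun x => f x * g x)| <=
    Num.sqrt (Ex (fun x => f x ^+ 2)) * Num.sqrt (Ex (fun x => g x ^+ 2)).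
Proof.
move=> mf mg If Ig; have Ifg := intgM_L2 mf mg If Ig.
have Ef0 : 0 <= Ex (fun x => f x ^+ 2) by apply: Ex_ge0 => x; exact: sqr_ge0.
have Eg0 : 0 <= Ex (fun x => g x ^+ 2) by apply: Ex_ge0 => x; exact: sqr_ge0.
rewrite -sqrtrM // -sqrtr_sqr ler_wsqrtr //; apply: quadratic_ge0 => // t.
have -> : Ex (fun x => f x ^+ 2) - 2 * t * Ex (fun x => f x * g x) +
    t ^+ 2 * Ex (fun x => g x ^+ 2) = Ex (fun x => (f x - t * g x) ^+ 2).
  have -> : (fun x => (f x - t * g x) ^+ 2) =
      (fun x => f x ^+ 2 - 2 * t * (f x * g x) + t ^+ 2 * g x ^+ 2).
    by apply/funext => x; ring.
  by rewrite ExD ?ExB ?ExZ //; [exact: intgZ|apply: intgB => //; exact: intgZ|exact: intgZ].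
by apply: Ex_ge0 => x; exact: sqr_ge0.
Qed.

Lemma Cauchy_Schwarz_pr f (b : T -> bool) : measurable_fun setT f ->
  intg (fun x => f x ^+ 2) -> measurable [set x | b x] ->
  `|Ex (fun x => f x * (b x)%:R)| <=
    Num.sqrt (Ex (fun x => f x ^+ 2)) * Num.sqrt (pr [set x | b x]).
Proof.
move=> mf If mb; have Ib := intg_pred mb.
have bb : (fun x => (b x)%:R ^+ 2) = (fun x => (b x)%:R) :> (T -> R).
  by apply/funext => x; case: (b x); rewrite ?expr1n ?expr0n.
have := Cauchy_Schwarz mf (intg_measurable Ib) If; rewrite bb Ex_pr //; exact.
Qed.

End RealExpectation.

Section Independence.
Context d (T : measurableType d) (R : realType) (P : probability T R).
Implicit Types (A B : T -> R).

Definition indep A B : Prop := forall S1 S2 : set R, measurable S1 -> measurable S2 ->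
  P ((A @^-1` S1) `&` (B @^-1` S2)) = (P (A @^-1` S1) * P (B @^-1` S2))%E.

Definition joint A B (w : T) : R * R := (A w, B w).

Lemma measurable_joint A B : measurable_fun setT A -> measurable_fun setT B ->
  measurable_fun setT (joint A B).
Proof. by move=> mA mB; exact: measurable_fun_pair. Qed.

Section Law.
Variables (A B : T -> R).
Hypotheses (mA : measurable_fun setT A) (mB : measurable_fun setT B).

Let RA : {mfun T >-> R} := mfun_Sub (mem_set mA).
Let RB : {mfun T >-> R} := mfun_Sub (mem_set mB).
Let RAB : {mfun T >-> (R * R)%type} := mfun_Sub (mem_set (measurable_joint mA mB)).

(** The restriction of [P] to [E], transported by the pair, agrees on rectangles with a multiple of
    the product law, hence everywhere. The event [E] lets an induction carry the variables that are
    not yet summed. *)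
Lemma joint_law_restr (E : set T) : measurable E ->
  (forall S1 S2 : set R, measurable S1 -> measurable S2 ->
    P (E `&` ((A @^-1` S1) `&` (B @^-1` S2))) =
      (P E * (P (A @^-1` S1) * P (B @^-1` S2)))%E) ->
  forall Z : set (R * R), measurable Z ->
    P (E `&` joint A B @^-1` Z) = (P E * (distribution P RA \x distribution P RB) Z)%E.
Proof.
move=> mE PE Z mZ.
pose c : {nonneg R} := NngNum (fine_ge0 (measure_ge0 P E)).
have cE : (c%:num)%:E = P E by rewrite fineK // fin_num_measure.
pose m' := measure_function_pushforward__canonical__measure_function_Measure
  (mrestr P mE) (measurable_joint mA mB).
have m'E S : m' S = P (joint A B @^-1` S `&` E) by [].
rewrite setIC -m'E -(@product_measure_unique _ _ _ _ R
  (mscale c (distribution P RA)) (distribution P RB) m') //; last first.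
  move=> S1 S2 mS1 mS2; rewrite m'E.
  transitivity (P E * P (A @^-1` S1) * P (B @^-1` S2))%E; last by rewrite -cE.
  by rewrite -muleA -PE // setIC.
rewrite /product_measure1 ge0_integral_mscale ?cE //.
exact: measurable_fun_xsection.
Qed.

Lemma joint_law : indep A B -> forall Z : set (R * R), measurable Z ->
  P (joint A B @^-1` Z) = (distribution P RA \x distribution P RB)%E Z.
Proof.
move=> AB Z mZ; have PT : P setT = 1%E := probability_setT P.
have := @joint_law_restr setT measurableT _ Z mZ; rewrite setTI PT mul1e; apply.
by move=> S1 S2 mS1 mS2; rewrite setTI mul1e AB.
Qed.

(* Fubini: given [B = y], only the conditional expectation of [F (A, y)] matters. *)
Lemma indep_Ex_eq (F G : R * R -> R) : indep A B ->
  measurable_fun setT F -> measurable_fun setT G ->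
  intg P (fun w => F (A w, B w)) -> intg P (fun w => G (A w, B w)) ->
  (forall y, intg P (fun w => F (A w, y))) ->
  (forall y, intg P (fun w => G (A w, y))) ->
  (forall y, Ex P (fun w => F (A w, y)) = Ex P (fun w => G (A w, y))) ->
  Ex P (fun w => F (A w, B w)) = Ex P (fun w => G (A w, B w)).
Proof.
move=> AB mF mG IF IG IFy IGy FG.
have ExB (H : R * R -> R) : measurable_fun setT H ->
    intg P (fun w => H (A w, B w)) -> (forall y, intg P (fun w => H (A w, y))) ->
    Ex P (fun w => H (A w, B w)) = fine (\int[distribution P RB]_y
      (Ex P (fun w => H (A w, y)))%:E)%E.
  move=> mH IH IHy; rewrite /Ex {1}/Rintegral; congr fine.
  have -> : (\int[P]_w (H (A w, B w))%:E = \int[distribution P RAB]_z (H z)%:E)%E.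
    by rewrite integral_distribution //; exact/measurable_EFinP.
  have law (f : R * R -> \bar R) : (\int[distribution P RAB]_z f z =
      \int[distribution P RA \x distribution P RB]_z f z)%E.
    by apply: eq_measure_integral => Z mZ _; exact: joint_law.
  rewrite law -integral21_prod_meas1 /fubini_G //=; last first.
    apply/integrableP; split; first exact/measurable_EFinP.
    rewrite -law ge0_integral_distribution //; first by case/integrableP: IH.
    by apply: measurableT_comp => //; exact/measurable_EFinP.
  apply: eq_integral => y _; rewrite integral_distribution //.
  - by rewrite /Rintegral fineK //; exact: integrable_fin_num (IHy y).
  - apply/measurable_EFinP; apply: measurableT_comp mH _.
    exact: measurable_fun_pair.
  - exact: IHy.
by rewrite !ExB //; congr fine; apply: eq_integral => y _; rewrite FG.
Qed.

End Law.
End Independence.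

(** * Independence of one variable from a partial sum of the others *)

Section IndependentSums.
Context d (T : measurableType d) (R : realType) (P : probability T R).
Variable X : nat -> {RV P >-> R}.
Hypothesis X_indep : mutually_independent X.
Implicit Types (I J : seq nat).

Lemma measurable_RV i : measurable_fun setT (X i : T -> R).
Proof. exact: measurable_funPT. Qed.

Definition psum J (w : T) : R := \sum_(j <- J) X j w.

Lemma measurable_psum J : measurable_fun setT (psum J).
Proof. by apply: measurable_sum => j; exact: measurable_RV. Qed.

Let cyl (B : nat -> set R) I := \bigcap_(i in [set` I]) (X i @^-1` B i).

Let measurable_cyl B I : (forall i, measurable (B i)) -> measurable (cyl B I).
Proof.
move=> mB; apply: fin_bigcap_measurable => // i _.
by rewrite -[X in measurable X]setTI; exact: measurable_RV.
Qed.

Let cylE B I : uniq I -> (forall i, measurable (B i)) ->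
  P (cyl B I) = (\prod_(i <- I) P (X i @^-1` B i))%E.
Proof. exact: X_indep. Qed.

Let setB (B : nat -> set R) j S i := if i == j then S else B i.

Let cyl_cons B I j S : uniq (j :: I) ->
  cyl (setB B j S) (j :: I) = X j @^-1` S `&` cyl B I.
Proof.
move=> /= /andP[jI _]; apply/seteqP; split => w /=.
  move=> H; split; first by have := H j; rewrite /= mem_head /setB eqxx; apply.
  move=> i /= iI; have := H i; rewrite /= inE iI orbT /setB.
  by case: eqP => [ij|_]; [move: jI; rewrite -ij iI|apply].
move=> [wS wI] i /=; rewrite inE /setB; case: eqP => [-> //|_] /= iI.
exact: wI.
Qed.

(** Mutual independence speaks of cylinders only. Induction on [J] moves the first index from the
    sum into the cylinder: on [cyl B I] the pair [(X j, psum J)] has a product law, and the event on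
    [X j + psum J] is the preimage of a planar set. *)
Lemma cyl_psum_indep J I B C : uniq (I ++ J) -> (forall i, measurable (B i)) ->
  measurable C ->
  P (cyl B I `&` psum J @^-1` C) = (P (cyl B I) * P (psum J @^-1` C))%E.
Proof.
elim: J I B C => [|j J IH] I B C uIJ mB mC.
  have -> : psum [::] = cst 0 by apply/funext => w; rewrite /psum big_nil.
  rewrite preimage_cst; case: ifP => _.
    by rewrite setIT (_ : P setT = 1%E) ?mule1 //; exact: probability_setT.
  by rewrite setI0 measure0 mule0.
have uJ : uniq (j :: J) by move: uIJ; rewrite cat_uniq => /and3P[].
have ujIJ : uniq ((j :: I) ++ J) by move: uIJ; rewrite -[j :: J]/([:: j] ++ J) uniq_catCA.
have ujI : uniq (j :: I) by move: ujIJ; rewrite cat_uniq => /andP[].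
have mSB S : measurable S -> forall i, measurable (setB B j S i).
  by move=> mS i; rewrite /setB; case: ifP.
have PjI S : measurable S ->
    P (cyl (setB B j S) (j :: I)) = (P (cyl B I) * P (X j @^-1` S))%E.
  move=> mS; have uI : uniq I by move: ujI => /andP[].
  rewrite (cylE ujI (mSB S mS)) (cylE uI mB) big_cons /setB eqxx muleC.
  congr (_ * _)%E; apply: eq_big_seq => i iI; case: eqP => // ij.
  by move: ujI; rewrite /= -ij iI.
pose Z := [set z : R * R | C (z.1 + z.2)].
have mZ : measurable Z.
  rewrite -[Z]setTI; have mD : measurable_fun [set: R * R] (fun z : R * R => z.1 + z.2).
    by apply: measurable_funD; [exact: measurable_fst|exact: measurable_snd].
  exact: mD.
have psumE : psum (j :: J) @^-1` C = joint (X j) (psum J) @^-1` Z.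
  by apply/seteqP; split => w; rewrite /Z /psum /= big_cons.
have jJ : indep P (X j) (psum J).
  move=> S1 S2 mS1 mS2.
  have := IH [:: j] (setB (fun=> setT) j S1) S2 uJ; rewrite cyl_cons //.
  have -> : cyl (fun=> setT) [::] = setT by rewrite /cyl set_nil bigcap_set0.
  rewrite setIT; apply => // i; rewrite /setB; case: ifP => // _.
rewrite psumE (joint_law (measurable_RV j) (measurable_psum J)) //.
apply: joint_law_restr => //; first exact: measurable_cyl.
move=> S1 S2 mS1 mS2; rewrite setIA [X in P (X `&` _)]setIC -(cyl_cons B S1 ujI).
by rewrite IH ?PjI ?muleA //; exact: mSB.
Qed.

Lemma indep_psum i J : uniq (i :: J) -> indep P (X i) (psum J).
Proof.
move=> uiJ S1 S2 mS1 mS2.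
have := @cyl_psum_indep J [:: i] (setB (fun=> setT) i S1) S2 uiJ; rewrite cyl_cons //.
have -> : cyl (fun=> setT) [::] = setT by rewrite /cyl set_nil bigcap_set0.
by rewrite setIT; apply => // k; rewrite /setB; case: ifP.
Qed.

Lemma indep_pair i j : i != j -> indep P (X i) (X j).
Proof.
move=> ij; have : psum [:: j] = X j by apply/funext => w; rewrite /psum big_seq1.
by move=> <-; apply: indep_psum; rewrite /= inE ij.
Qed.

End IndependentSums.

(** * Sums of bounded independent variables *)

Lemma measurable_testfun' {R : realType} (v h M L : R) :
  measurable_fun setT (testfun' v h M L).
Proof.
have mflat Q (c e : R) : measurable_fun setT (fun x : R => flat Q (c * x + e)).
  apply: measurableT_comp; last by apply: measurable_funD => //; exact: measurable_funM.
  apply: continuous_measurable_fun => x.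
  exact: is_derive_continuous (is_derive_flat Q x).
have -> : testfun' v h M L = (fun x =>
    h^-1 * flat ('X ^+ 2) (h^-1 * x + - v / h) * flat 1 (- L^-1 * x + M / L) -
    flat 1 (h^-1 * x + - v / h) * (L^-1 * flat ('X ^+ 2) (- L^-1 * x + M / L))).
  apply/funext => x; rewrite /testfun' /flat1'.
  have -> : (x - v) / h = h^-1 * x + - v / h by ring.
  have -> : (M - x) / L = - L^-1 * x + M / L by ring.
  by ring.
apply: measurable_funB; apply: measurable_funM => //; apply: measurable_funM => //.
Qed.

Section ProbabilityRealFun.
Context d (T : measurableType d) (R : realType).

Lemma measurable_gt (f : T -> R) (c : R) : measurable_fun setT f ->
  measurable [set w | c < f w].
Proof.
move=> mf; have -> : [set w | c < f w] = setT `&` f @^-1` `]c, +oo[.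
  by apply/seteqP; split => w /=; rewrite in_itv /= andbT; [split|case].
by apply: mf => //; exact: measurable_itv.
Qed.

Lemma measurable_window (f : T -> R) (c e : R) : measurable_fun setT f ->
  measurable [set w | c < f w <= e].
Proof.
move=> mf; have -> : [set w | c < f w <= e] = setT `&` f @^-1` `]c, e].
  by apply/seteqP; split => w /=; rewrite in_itv /=; [split|case].
by apply: mf => //; exact: measurable_itv.
Qed.

Lemma intg_L2 (P : probability T R) (f : T -> R) : measurable_fun setT f ->
  intg P (fun w => f w ^+ 2) -> intg P f.
Proof.
move=> mf If; apply: intg_dom mf _ (intgD (intg_cst P 1) If) => w.
rewrite -(real_normK (num_real (f w))); have := sqr_ge0 (`|f w| - 1).
have := normr_ge0 (f w); nra.
Qed.

End ProbabilityRealFun.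

Section BoundedSums.
Context d (T : measurableType d) (R : realType) (P : probability T R).
Variables (Y : nat -> {RV P >-> R}) (s : R -> R) (a b : R).
Hypothesis Y_indep : mutually_independent Y.
Hypothesis Y_id : identically_distributed Y.
Hypothesis Y_ab : forall i w, a <= Y i w <= b.
Hypothesis s_meas : measurable_fun setT s.
Hypothesis s_L2 : intg P (fun w => s (Y 0%N w) ^+ 2).
Hypothesis s_ibp : forall v h M L, 0 < h -> 0 < L ->
  Ex P (fun w => s (Y 0%N w) * testfun v h M L (Y 0%N w)) =
  - Ex P (fun w => testfun' v h M L (Y 0%N w)).

Let mY i : measurable_fun setT (Y i : T -> R). Proof. exact: measurable_RV. Qed.

Let mfY (f : R -> R) i : measurable_fun setT f -> measurable_fun setT (fun w => f (Y i w)).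
Proof. by move=> mf; exact: measurableT_comp. Qed.

Lemma id_Ex (f : R -> R) i : measurable_fun setT f -> intg P (fun w => f (Y 0%N w)) ->
  intg P (fun w => f (Y i w)) /\ Ex P (fun w => f (Y i w)) = Ex P (fun w => f (Y 0%N w)).
Proof.
move=> mf If.
have law (g : R -> \bar R) :
    (\int[distribution P (Y i)]_x g x = \int[distribution P (Y 0%N)]_x g x)%E.
  by apply: eq_measure_integral => S mS _; exact: Y_id.
have mfE : measurable_fun setT (EFin \o f) by exact/measurable_EFinP.
have Ii : intg P (fun w => f (Y i w)).
  apply/integrableP; split; first by apply/measurable_EFinP; exact: mfY.
  have mfa : measurable_fun setT (fun x => `|(f x)%:E|%E) by exact: measurableT_comp.
  have /= <- := ge0_integral_distribution (Y i) mfa (fun=> abse_ge0 _).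
  rewrite law (ge0_integral_distribution (Y 0%N) mfa (fun=> abse_ge0 _)).
  by case/integrableP: If.
split => //; rewrite /Ex /Rintegral; congr fine.
have /= <- := @integral_distribution _ _ _ _ _ P (Y i) _ mfE Ii.
by rewrite law; exact: (@integral_distribution _ _ _ _ _ P (Y 0%N) _ mfE If).
Qed.

Let s_L1 : intg P (fun w => s (Y 0%N w)).
Proof.
by apply: intg_L2 => //; exact: mfY.
Qed.

(* Constants are not compactly supported: the identity is tested on ever wider bumps. *)
Lemma score_mean0 : Ex P (fun w => s (Y 0%N w)) = 0.
Proof.
set E := Ex P _; pose A := Ex P (fun w => `|s (Y 0%N w)|).
have A0 : 0 <= A by exact: Ex_ge0.
(* The value at 0 of the bump [testfun (- 2 * L) L (2 * L) L], the same for every width [L]. *)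
pose kappa : R := flat 1 2 * flat 1 2.
have kappa0 : 0 < kappa.
  by rewrite mulr_gt0 //; apply: lt_le_trans (expR_gt0 (- 1)) _; apply: flat1_ge; lra.
pose B := Num.max `|a| `|b|.
have YB w : `|Y 0%N w| <= B.
  have /andP[aY Yb] := Y_ab 0%N w; rewrite /B le_max.
  have [Y0|Y0] := leP 0 (Y 0%N w).
    by rewrite (ger0_norm Y0) orbC (le_trans Yb) // ler_norm.
  rewrite ltr0_norm //; apply/orP; left.
  by rewrite -normrN; apply: le_trans (ler_norm _); lra.
have B0 : 0 <= B by rewrite le_max normr_ge0.
(* On the bounded range of [Y] the bump differs from [kappa] by [O(1/L)], and the expectation of its
   derivative is [O(1/L)] as well. So [L * |E|] stays bounded as [L] grows, which forces [E = 0]. *)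
have main L : 0 < L -> L * (kappa * `|E|) <= 4 + 4 * B * A.
  move=> L0; pose psi := testfun (- 2 * L) L (2 * L) L.
  have L_neq0 : L != 0 by rewrite gt_eqF.
  have psi0 : psi 0 = kappa.
    by rewrite /psi /testfun; congr (flat _ _ * flat _ _); field.
  have dpsi x := is_derive_testfun (- 2 * L) L (2 * L) L x.
  have psi'_le x : `|testfun' (- 2 * L) L (2 * L) L x| <= 4 / L.
    by apply: le_trans (testfun'_bounded _ _ _ L0 L0) _; lra.
  have psi_lip x : `|psi x - kappa| <= 4 / L * `|x|.
    have mono (u v : R) : u <= v -> `|psi v - psi u| <= 4 / L * (v - u).
      move=> uv.
      have inc1 : 4 / L * u + psi u <= 4 / L * v + psi v.
        apply: (@is_derive_le R (fun t => 4 / L * t + psi t)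
          (fun t => 4 / L + testfun' (- 2 * L) L (2 * L) L t) _ _ uv) => t _.
          apply: is_derive_conv (is_derive_addf (is_derive_mulf (is_derive_cstf (4 / L) t)
            (is_derive_idf t)) (dpsi t)) _.
          by ring.
        by have := psi'_le t; rewrite ler_norml; lra.
      have inc2 : 4 / L * u - psi u <= 4 / L * v - psi v.
        apply: (@is_derive_le R (fun t => 4 / L * t - psi t)
          (fun t => 4 / L - testfun' (- 2 * L) L (2 * L) L t) _ _ uv) => t _.
          apply: is_derive_conv (is_derive_subf (is_derive_mulf (is_derive_cstf (4 / L) t)
            (is_derive_idf t)) (dpsi t)) _.
          by ring.
        by have := psi'_le t; rewrite ler_norml; lra.
      by rewrite ler_norml; lra.
    rewrite -psi0; have [x0|x0] := leP 0 x.
      by have := mono _ _ x0; rewrite subr0 (ger0_norm x0).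
    by have := mono _ _ (ltW x0); rewrite distrC sub0r (ltr0_norm x0).
  have mpsi : measurable_fun setT (fun w => psi (Y 0%N w)).
    exact: mfY (measurable_testfun _ _ _ _).
  have Ipsi : intg P (fun w => s (Y 0%N w) * psi (Y 0%N w)).
    apply: intg_dom (intg_norm s_L1) => [|w].
      by apply: measurable_funM => //; exact: mfY.
    by rewrite normrM ler_piMr // ger0_norm ?testfun_ge0 // testfun_le1.
  have Ipsik : intg P (fun w => s (Y 0%N w) * (psi (Y 0%N w) - kappa)).
    under eq_fun do rewrite mulrBr [X in _ - X]mulrC.
    by apply: intgB => //; exact: intgZ.
  have split : kappa * E = Ex P (fun w => s (Y 0%N w) * psi (Y 0%N w)) -
      Ex P (fun w => s (Y 0%N w) * (psi (Y 0%N w) - kappa)).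
    by rewrite -ExB // /E -ExZ //; congr (Ex P _); apply/funext => w; ring.
  have I' : intg P (fun w => testfun' (- 2 * L) L (2 * L) L (Y 0%N w)).
    apply: (@intg_bounded _ _ _ _ _ (4 / L)) => //.
    exact: mfY (measurable_testfun' _ _ _ _).
  have le1 : `|Ex P (fun w => s (Y 0%N w) * psi (Y 0%N w))| <= 4 / L.
    rewrite s_ibp // normrN; apply: le_trans (Ex_norm I') _.
    by rewrite -[leRHS](Ex_cst P); apply: Ex_le => //; [exact: intg_norm|exact: intg_cst].
  have le2 : `|Ex P (fun w => s (Y 0%N w) * (psi (Y 0%N w) - kappa))| <= 4 / L * B * A.
    apply: le_trans (Ex_norm Ipsik) _; rewrite /A -ExZ; last exact: intg_norm.
    apply: Ex_le => [||w]; [exact: intg_norm|by apply: intgZ; exact: intg_norm|].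
    rewrite normrM mulrC ler_wpM2r //; apply: le_trans (psi_lip _) _.
    by rewrite ler_wpM2l // divr_ge0 // ltW.
  have kE : kappa * `|E| <= 4 / L + 4 / L * B * A.
    rewrite -(gtr0_norm kappa0) -normrM split.
    by apply: le_trans (ler_normB _ _) _; exact: lerD.
  have -> : 4 + 4 * B * A = L * (4 / L + 4 / L * B * A) by field.
  by rewrite ler_pM2l.
have C0 : 0 <= 4 + 4 * B * A by rewrite addr_ge0 ?mulr_ge0.
apply/eqP; rewrite -normr_eq0; apply: contraT => E0.
have kE : 0 < kappa * `|E| by rewrite mulr_gt0 // lt_def E0 /=.
have L0 : 0 < (4 + 4 * B * A + 1) / (kappa * `|E|) by rewrite divr_gt0 //; lra.
have := main _ L0; rewrite divfK ?gt_eqF //; lra.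
Qed.

(** Independent centred terms are orthogonal. Applied three times: to the score, to the normalized
    summands for [E W^2 = 1], and to their centred squares. *)
Lemma centered_sum_L2 (f : R -> R) J : uniq J -> measurable_fun setT f ->
  intg P (fun w => f (Y 0%N w) ^+ 2) -> Ex P (fun w => f (Y 0%N w)) = 0 ->
  intg P (fun w => (\sum_(i <- J) f (Y i w)) ^+ 2) /\
  Ex P (fun w => (\sum_(i <- J) f (Y i w)) ^+ 2) =
    (size J)%:R * Ex P (fun w => f (Y 0%N w) ^+ 2).
Proof.
move=> uJ mf If2 Ef.
have mf2 : measurable_fun setT (fun x => f x ^+ 2) by exact: measurable_funX.
have If2i i := (id_Ex i mf2 If2).1; have Ef2i i := (id_Ex i mf2 If2).2.
have Iprod i j : intg P (fun w => f (Y i w) * f (Y j w)).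
  by apply: intgM_L2 => //; exact: mfY.
have Ifi i : intg P (fun w => f (Y i w)).
  by apply: intg_L2 => //; exact: mfY.
have Efi i : Ex P (fun w => f (Y i w)) = 0 by rewrite (id_Ex i mf (Ifi 0%N)).2.
have cross i j : i != j -> Ex P (fun w => f (Y i w) * f (Y j w)) = 0.
  move=> ij; rewrite -[RHS](Ex_cst P 0).
  apply: (@indep_Ex_eq _ _ _ P (Y i) (Y j) _ _ (fun z => f z.1 * f z.2) (fun=> 0)) => //.
  - exact: indep_pair.
  - by apply: measurable_funM; apply: measurableT_comp.
  - exact: Iprod.
  - exact: intg_cst.
  - move=> y /=; under eq_fun do rewrite mulrC; exact: intgZ.
  - by move=> y; exact: intg_cst.
  - move=> y /=; rewrite Ex_cst; under eq_fun do rewrite mulrC.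
    by rewrite ExZ // Efi mulr0.
elim: J uJ => [_|j J IH /= /andP[jJ uJ]].
  under eq_fun do rewrite big_nil expr0n.
  by rewrite mul0r Ex_cst; split => //; exact: intg_cst.
have [IJ EJ] := IH uJ.
have cr : Ex P (fun w => f (Y j w) * \sum_(i <- J) f (Y i w)) = 0.
  under eq_fun do rewrite mulr_sumr.
  rewrite Ex_sum // big_seq big1 // => i iJ; apply: cross.
  by apply: contraNneq jJ => ->.
have Icr : intg P (fun w => f (Y j w) * \sum_(i <- J) f (Y i w)).
  by under eq_fun do rewrite mulr_sumr; exact: intg_sum.
have sqE : (fun w => (\sum_(i <- j :: J) f (Y i w)) ^+ 2) = (fun w =>
    f (Y j w) ^+ 2 + (2 * (f (Y j w) * \sum_(i <- J) f (Y i w)) +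
    (\sum_(i <- J) f (Y i w)) ^+ 2)).
  by apply/funext => w; rewrite big_cons; ring.
have I2 := intgZ 2 Icr; rewrite sqE; split.
  by apply: intgD => //; exact: intgD.
rewrite ExD //; last exact: intgD.
by rewrite ExD // ExZ // cr mulr0 add0r EJ Ef2i -natr1; ring.
Qed.

Lemma psum_rem J i w : i \in J -> psum Y J w = Y i w + psum Y (rem i J) w.
Proof. by move=> iJ; rewrite /psum (big_rem i). Qed.

Lemma indep_rem J i : uniq J -> i \in J -> indep P (Y i) (psum Y (rem i J)).
Proof.
move=> uJ iJ; apply: indep_psum => //=; rewrite rem_uniq // andbT.
by rewrite mem_rem_uniqF.
Qed.

(** With the other summands frozen at [y], the test function of the sum is again a test function of
    [Y i], with [v] and [M] translated by [y]. The one-variable identity thus applies for each [y],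
    and independence integrates it. *)
Lemma sum_ibp J i v h M L : uniq J -> i \in J -> 0 < h -> 0 < L ->
  intg P (fun w => s (Y i w) * testfun v h M L (psum Y J w)) /\
  Ex P (fun w => s (Y i w) * testfun v h M L (psum Y J w)) =
  - Ex P (fun w => testfun' v h M L (psum Y J w)).
Proof.
move=> uJ iJ h0 L0.
have mS : measurable_fun setT (psum Y J) by exact: measurable_psum.
have sYi := (id_Ex i s_meas s_L1).1.
have Is (g : T -> R) : measurable_fun setT g -> (forall w, 0 <= g w <= 1) ->
    intg P (fun w => s (Y i w) * g w).
  move=> mg g01; apply: intg_dom (intg_norm sYi) => [|w].
    by apply: measurable_funM => //; exact: mfY.
  by have /andP[g0 g1] := g01 w; rewrite normrM ler_piMr // ger0_norm.
have t01 v' M' x : 0 <= testfun v' h M' L x <= 1.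
  by rewrite testfun_ge0 testfun_le1.
have It' (g : T -> R) v' M' : measurable_fun setT g ->
    intg P (fun w => - 1 * testfun' v' h M' L (g w)).
  move=> mg; apply: intgZ; apply: (@intg_bounded _ _ _ _ _ (2 / h + 2 / L)).
    by apply: measurableT_comp mg; exact: measurable_testfun'.
  by move=> w; exact: testfun'_bounded.
split; first by apply: Is => // ; apply: measurableT_comp mS; exact: measurable_testfun.
pose F z := s z.1 * testfun v h M L (z.1 + z.2).
pose G z := - 1 * testfun' v h M L (z.1 + z.2).
have madd : measurable_fun setT (fun z : R * R => z.1 + z.2).
  by apply: measurable_funD; [exact: measurable_fst|exact: measurable_snd].
have FE w : s (Y i w) * testfun v h M L (psum Y J w) = F (Y i w, psum Y (rem i J) w).
  by rewrite (psum_rem w iJ).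
have GE w : - 1 * testfun' v h M L (psum Y J w) = G (Y i w, psum Y (rem i J) w).
  by rewrite (psum_rem w iJ).
have IS' : intg P (fun w => testfun' v h M L (psum Y J w)).
  have := intgZ (- 1) (It' _ v M mS).
  by under eq_fun do rewrite mulrA mulN1r opprK mul1r.
rewrite -mulN1r -ExZ //.
under eq_fun do rewrite FE; under [in RHS]eq_fun do rewrite GE.
have mR : measurable_fun setT (psum Y (rem i J)) by exact: measurable_psum.
have mF : measurable_fun setT F.
  apply: measurable_funM; apply: measurableT_comp => //.
  exact: measurable_testfun.
have mG : measurable_fun setT G.
  by apply: measurable_funM => //; apply: measurableT_comp => //; exact: measurable_testfun'.
apply: (indep_Ex_eq (mY i) mR) => //.
- exact: indep_rem.
- under eq_fun do rewrite -FE.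
  by apply: Is => //; apply: measurableT_comp mS; exact: measurable_testfun.
- by under eq_fun do rewrite -GE; exact: It'.
- move=> y; apply: Is => [|w]; last exact: t01.
  apply: measurableT_comp; first exact: measurable_testfun.
  exact: measurable_funD.
- by move=> y; apply: It'; exact: measurable_funD.
move=> y; rewrite /F /G /=.
under eq_fun do rewrite testfun_shift.
under [in RHS]eq_fun do rewrite testfun'_shift.
have Is0 (g : T -> R) : measurable_fun setT g -> (forall w, 0 <= g w <= 1) ->
    intg P (fun w => s (Y 0%N w) * g w).
  move=> mg g01; apply: intg_dom (intg_norm s_L1) => [|w].
    by apply: measurable_funM => //; exact: mfY.
  by have /andP[g0 g1] := g01 w; rewrite normrM ler_piMr // ger0_norm.
have mt := measurable_testfun (v - y) h (M - y) L.
have mt' := measurable_testfun' (v - y) h (M - y) L.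
have mst : measurable_fun setT (fun x => s x * testfun (v - y) h (M - y) L x).
  exact: measurable_funM.
have I1 : intg P (fun w => s (Y 0%N w) * testfun (v - y) h (M - y) L (Y 0%N w)).
  by apply: Is0 => [|w]; [exact: mfY|exact: t01].
have I2 : intg P (fun w => testfun' (v - y) h (M - y) L (Y 0%N w)).
  apply: (@intg_bounded _ _ _ _ _ (2 / h + 2 / L)); first exact: mfY.
  by move=> w; exact: testfun'_bounded.
have [_ E1] := id_Ex i mst I1; have [I2i E2] := id_Ex i mt' I2.
by rewrite ExZ // E1 E2 s_ibp // mulN1r.
Qed.

End BoundedSums.

(** First-order expansion of the ramp [(x - v)^+] in [v]. It is exact unless [x] lies within [|h|]
    of the kink, so its expected error is [|h|] times a window probability. *)
Lemma ramp_error {R : realType} (x v h : R) :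
  `|Num.max (x - (v + h)) 0 - Num.max (x - v) 0 + h * (v < x)%R%:R| <=
  `|h| * (v - `|h| < x <= v + `|h|)%R%:R.
Proof.
have hn := ler_norm h; have hn' : - h <= `|h| by rewrite -normrN ler_norm.
move: `|h| (normr_ge0 h) hn hn' => k k0 hn hn'.
have [x1|x1] := leP (x - (v + h)) 0; have [x2|x2] := leP (x - v) 0.
- have -> : (v < x) = false by apply/negbTE; rewrite -leNgt; lra.
  by rewrite mulr0 subrr addr0 normr0 mulr_ge0.
- have vx : v < x by lra.
  have vk : v - k < x by lra.
  have xk : x <= v + k by lra.
  by rewrite vx vk xk /= !mulr1 ler_norml; apply/andP; split; lra.
- have -> : (v < x) = false by apply/negbTE; rewrite -leNgt; lra.
  have vk : v - k < x by lra.
  have xk : x <= v + k by lra.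
  by rewrite vk xk /= mulr0 mulr1 addr0 ler_norml; apply/andP; split; lra.
have vx : v < x by lra.
have -> : x - (v + h) - (x - v) + h * (v < x)%R%:R = 0 by rewrite vx mulr1; ring.
by rewrite normr0 mulr_ge0.
Qed.

(** The same expansion in [x], meant for removing one summand [z] from the sum; the window uses a
    bound [e] common to all summands. *)
Lemma ramp_increment_error {R : realType} (x z v e : R) : `|z| <= e ->
  `|Num.max (x - v) 0 - Num.max (x - z - v) 0 - z * (v < x)%R%:R| <=
  `|z| * (v - e < x <= v + e)%R%:R.
Proof.
rewrite ler_norml => /andP[ze1 ze2].
have hn := ler_norm z; have hn' : - z <= `|z| by rewrite -normrN ler_norm.
move: `|z| (normr_ge0 z) hn hn' => k k0 hn hn'.
have [x1|x1] := leP (x - v) 0; have [x2|x2] := leP (x - z - v) 0.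
- have -> : (v < x) = false by apply/negbTE; rewrite -leNgt; lra.
  by rewrite mulr0 !subrr normr0 mulr_ge0.
- have -> : (v < x) = false by apply/negbTE; rewrite -leNgt; lra.
  have vk : v - e < x by lra.
  have xk : x <= v + e by lra.
  by rewrite vk xk /= mulr0 mulr1 subr0 ler_norml; apply/andP; split; lra.
- have vx : v < x by lra.
  have vk : v - e < x by lra.
  have xk : x <= v + e by lra.
  by rewrite vx vk xk /= !mulr1 ler_norml; apply/andP; split; lra.
have vx : v < x by lra.
have -> : x - v - (x - z - v) - z * (v < x)%R%:R = 0 by rewrite vx mulr1; ring.
by rewrite normr0 mulr_ge0.
Qed.

(** * Normal approximation of the normalized sum *)

Section NormalizedSum.
Context d (T : measurableType d) (R : realType) (P : probability T R).
Variables (Y : nat -> {RV P >-> R}) (s : R -> R) (a b s1 : R).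
Implicit Types v h x : R.
Hypothesis Y_indep : mutually_independent Y.
Hypothesis Y_id : identically_distributed Y.
Hypothesis Y_ab : forall i w, a <= Y i w <= b.
Hypothesis s_meas : measurable_fun setT s.
Hypothesis s_L2 : intg P (fun w => s (Y 0%N w) ^+ 2).
Hypothesis s_ibp : forall v h M L, 0 < h -> 0 < L ->
  Ex P (fun w => s (Y 0%N w) * testfun v h M L (Y 0%N w)) =
  - Ex P (fun w => testfun' v h M L (Y 0%N w)).
Hypothesis s1_gt0 : 0 < s1.
Let mu := Ex P (Y 0%N).
Hypothesis varY : Ex P (fun w => (Y 0%N w - mu) ^+ 2) = s1 ^+ 2.
Variable n : nat.
Hypothesis n_gt0 : (0 < n)%N.

Let J := iota 0 n.
Let uJ : uniq J := iota_uniq 0 n.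
Let sq := Num.sqrt (n%:R : R).
Let zeta i w := (Y i w - mu) / (s1 * sq).

Definition nsum w := \sum_(i <- iota 0 n) (Y i w - Ex P (Y 0%N)) / (s1 * Num.sqrt n%:R).

Let W := nsum.
Let p v := pr P [set w | v < W w].

Let n0 : 0 < (n%:R : R). Proof. by rewrite ltr0n. Qed.
Let sq0 : 0 < sq. Proof. by rewrite sqrtr_gt0. Qed.
Let sqsq : sq ^+ 2 = n%:R. Proof. by rewrite sqr_sqrtr // ltW. Qed.
Let ssq0 : 0 < s1 * sq. Proof. exact: mulr_gt0. Qed.

Let mY i : measurable_fun setT (Y i : T -> R). Proof. exact: measurable_RV. Qed.
Let IY i : intg P (Y i).
Proof.
apply: (@intg_bounded _ _ _ _ _ (`|a| + `|b|)) => // w.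
have /andP[] := Y_ab i w; have := ler_norm b; have := ler_norm (- a).
have := normr_ge0 a; have := normr_ge0 b.
by rewrite normrN ler_norml; lra.
Qed.

Let mu_ab : a <= mu <= b.
Proof.
rewrite -[a](Ex_cst P) -[b](Ex_cst P); apply/andP; split; apply: Ex_le => //;
  try exact: intg_cst; by move=> w; have /andP[] := Y_ab 0%N w.
Qed.

Let mW : measurable_fun setT W.
Proof.
apply: measurable_sum => i; apply: measurable_funM => //.
exact: measurable_funB.
Qed.

Let WE w : W w = (psum Y J w - n%:R * mu) / (s1 * sq).
Proof.
rewrite /W /nsum /psum -mulr_suml -/mu -/sq sumrB; congr ((_ - _) / _).
by rewrite big_const_seq count_predT size_iota iter_addr_0 mulr_natl.
Qed.

Let SE v w : (v < W w) = (n%:R * mu + v * (s1 * sq) < psum Y J w).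
Proof. by rewrite WE ltr_pdivlMr // ltrBrDl. Qed.

Let p_ge0 v : 0 <= p v. Proof. exact: pr_ge0. Qed.
Let p_le1 v : p v <= 1. Proof. by apply: pr_le1; exact: measurable_gt. Qed.

Let I2 := Ex P (fun w => s (Y 0%N w) ^+ 2).
(** The inverse of the lower bound [exp (-2) / (4 k)] of the step's derivative, with
    [k = s1 sqrt n h], times [(sqrt I2 + 2) / sqrt n]: the powers of [n] cancel. The summand 2 pays
    for the slow cutoff. *)
Definition conc_const := 4 * s1 / expR (- 2) *
  (Num.sqrt (Ex P (fun w => s (Y 0%N w) ^+ 2)) + 2).
Let Cc := conc_const.

Let Cc_ge0 : 0 <= Cc.
Proof.
rewrite mulr_ge0 ?addr_ge0 ?sqrtr_ge0 // divr_ge0 ?expR_ge0 // mulr_ge0 //.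
exact: ltW.
Qed.

Let window v h := pr P [set w | v < W w <= v + h].

(** The [n] equal terms [E psi'] are weighed against a sum of scores with standard deviation
    [sqrt (n I2)], so [E psi'] is [O(1 / sqrt n)]. On the window [psi'] is of order
    [1 / (sqrt n h)], which leaves a probability of order [h]. *)
Lemma concentration v h : 0 < h ->
  pr P [set w | v + h < W w <= v + 2 * h] <= Cc * h * Num.sqrt (p v).
Proof.
move=> h0.
pose k := s1 * sq * h; pose v' := n%:R * mu + v * (s1 * sq).
have k0 : 0 < k by rewrite mulr_gt0.
(* As [S <= n b], the sum stays at distance [sq] below [M], where the cutoff is still bounded below.
   Taking [sq] as cutoff scale makes its loss of order [1 / sq], like the main term. *)
pose M := n%:R * b + sq.
pose psi := testfun v' k M sq; pose psi' := testfun' v' k M sq.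
pose S := psum Y J.
have mS : measurable_fun setT S by exact: measurable_psum.
have mpsi : measurable_fun setT (fun w => psi (S w)).
  by apply: measurableT_comp mS; exact: measurable_testfun.
have Ipsi' : intg P (fun w => psi' (S w)).
  apply: (@intg_bounded _ _ _ _ _ (2 / k + 2 / sq)).
    by apply: measurableT_comp mS; exact: measurable_testfun'.
  by move=> w; exact: testfun'_bounded.
have S_le w : S w <= n%:R * b.
  apply: (le_trans (@ler_sum R nat J xpredT (fun i => Y i w) (fun=> b) _)) => [i _|].
    by have /andP[] := Y_ab i w.
  by rewrite big_const_seq count_predT size_iota iter_addr_0 mulr_natl.
have gtE : [set w | v < W w] = [set w | v' < S w].
  by apply/seteqP; split => w /=; rewrite SE.
have mgt : measurable [set w | v' < S w] by exact: measurable_gt.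
have winE : [set w | v + h < W w <= v + 2 * h] = [set w | v' + k < S w <= v' + 2 * k].
  have e1 : n%:R * mu + (v + h) * (s1 * sq) = v' + k by rewrite /v' /k; ring.
  have e2 : n%:R * mu + (v + 2 * h) * (s1 * sq) = v' + 2 * k by rewrite /v' /k; ring.
  by apply/seteqP; split => w /=; rewrite SE (leNgt (W w)) SE -leNgt e1 e2.
have mwin : measurable [set w | v' + k < S w <= v' + 2 * k] by exact: measurable_window.
have sum0 : `|Ex P (fun w => (\sum_(i <- J) s (Y i w)) * psi (S w))| <=
    Num.sqrt (n%:R * I2) * Num.sqrt (p v).
  have [IS ES] := centered_sum_L2 Y_indep Y_id uJ s_meas s_L2
     (score_mean0 Y_ab s_meas s_L2 s_ibp).
  rewrite /p gtE; apply: le_trans (Cauchy_Schwarz _ mpsi IS _) _.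
  - by apply: measurable_sum => i; exact: measurableT_comp.
  - apply: (@intg_bounded _ _ _ _ _ 1) => [|w]; first exact: measurable_funX.
    by rewrite ger0_norm ?sqr_ge0 // exprn_ile1 ?testfun_ge0 ?testfun_le1.
  rewrite ES size_iota ler_wpM2l ?sqrtr_ge0 // ler_wsqrtr // -Ex_pr //.
  apply: Ex_le => [||w]; last 1 first.
  - apply: le_trans (testfun_le v' M sq (S w) k0).
    by rewrite expr2 ler_piMl ?testfun_ge0 ?testfun_le1.
  - apply: (@intg_bounded _ _ _ _ _ 1) => [|w]; first exact: measurable_funX.
    by rewrite ger0_norm ?sqr_ge0 // exprn_ile1 ?testfun_ge0 ?testfun_le1.
  - exact: intg_pred.
have sumE : Ex P (fun w => (\sum_(i <- J) s (Y i w)) * psi (S w)) =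
    - (n%:R * Ex P (fun w => psi' (S w))).
  have Is i : intg P (fun w => s (Y i w) * psi (S w)).
    have msY : measurable_fun setT (fun w => s (Y i w)) by exact: measurableT_comp.
    have Isi := (id_Ex Y_id i (measurable_funX 2 s_meas) s_L2).1.
    apply: intg_dom (intg_norm (intg_L2 msY Isi)) => [|w]; first exact: measurable_funM.
    by rewrite normrM ler_piMr // ger0_norm ?testfun_ge0 ?testfun_le1.
  under eq_fun do rewrite mulr_suml.
  rewrite Ex_sum // (@eq_big_seq _ _ _ _ _ _ (fun=> - Ex P (fun w => psi' (S w)))) /=.
    by rewrite big_const_seq count_predT size_iota iter_addr_0 mulNrn mulr_natl.
  move=> i iJ.
  by have [] := sum_ibp Y_indep Y_id s_meas s_L2 s_ibp v' M uJ iJ k0 sq0.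
have low : expR (- 2) / (4 * k) * window (v + h) h - 2 / sq * p v <= Ex P (fun w => psi' (S w)).
  rewrite /window (_ : v + h + h = v + 2 * h) ?winE; last by ring.
  rewrite /p gtE -!Ex_pr // -!ExZ; [|exact: intg_pred|exact: intg_pred].
  rewrite -ExB; [|by apply: intgZ; exact: intg_pred|by apply: intgZ; exact: intg_pred].
  apply: Ex_le => [||w] //.
    by apply: intgB; apply: intgZ; exact: intg_pred.
  by apply: testfun'_ge => //; rewrite /M lerD2r.
rewrite (_ : v + 2 * h = v + h + h) -/(window (v + h) h); last by ring.
(* The cutoff loss is proportional to [p v]; since [p v <= 1] it can be merged with the term in
   [sqrt (p v)]. *)
have psqrt : p v <= Num.sqrt (p v).
  by rewrite -{1}(sqr_sqrtr (p_ge0 v)) expr2 ler_piMr ?sqrtr_ge0 // -sqrtr1 ler_wsqrtr.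
have up : Ex P (fun w => psi' (S w)) <= Num.sqrt I2 / sq * Num.sqrt (p v).
  move: sum0; rewrite sumE normrN normrM (gtr0_norm n0) sqrtrM ?(ltW n0) // -/sq -sqsq.
  rewrite expr2 -!mulrA ler_pM2l // -ler_pdivlMl // => /(le_trans (ler_norm _)).
  by rewrite mulrCA mulrA.
have e2 : 0 < expR (- 2) :> R by exact: expR_gt0.
have win : expR (- 2) / (4 * k) * window (v + h) h <= (Num.sqrt I2 + 2) / sq * Num.sqrt (p v).
  have : 2 / sq * p v <= 2 / sq * Num.sqrt (p v).
    by rewrite ler_wpM2l // divr_ge0 // ltW.
  have -> : (Num.sqrt I2 + 2) / sq * Num.sqrt (p v) =
    Num.sqrt I2 / sq * Num.sqrt (p v) + 2 / sq * Num.sqrt (p v) by ring.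
  by move: low up; lra.
have c0 : 0 < expR (- 2) / (4 * k) by rewrite divr_gt0 // mulr_gt0.
rewrite -(ler_pM2l c0); apply: le_trans win _.
rewrite le_eqVlt; apply/orP; left; apply/eqP; rewrite /Cc /conc_const -/I2 /k.
by field; rewrite !gt_eqF.
Qed.

(** [concentration] controls a window that starts one step beyond its base point; base point
    [v - 3 h] and step [2 h] give the symmetric window. The shift [3 * z1] in [Stein_bound]
    originates here. *)
Let sym_window v h : 0 < h ->
  pr P [set w | v - h < W w <= v + h] <= Cc * (2 * h) * Num.sqrt (p (v - 3 * h)).
Proof.
move=> h0; have h2 : 0 < 2 * h by rewrite mulr_gt0.
have := @concentration (v - 3 * h) (2 * h) h2.
rewrite (_ : v - 3 * h + 2 * h = v - h); last by ring.
by rewrite (_ : v - 3 * h + 2 * (2 * h) = v + h) //; ring.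
Qed.

Let sqrtp_le1 v : Num.sqrt (p v) <= 1.
Proof. by rewrite -[leRHS]sqrtr1 ler_wsqrtr. Qed.

Let sym_window1 v h : 0 < h ->
  pr P [set w | v - h < W w <= v + h] <= 2 * Cc * h.
Proof.
move=> h0; apply: le_trans (sym_window v h0) _.
rewrite mulrA [Cc * 2]mulrC ler_piMr // !mulr_ge0 //; exact: ltW.
Qed.

(** The added 1 makes [z1], a uniform bound on the normalized summands, strictly positive, as a
    window width must be. *)
Let B1 := (b - a + 1) / s1.
Let z1 := (b - a + 1) / (s1 * sq).
Let zeta_le i w : `|zeta i w| <= z1.
Proof.
rewrite /zeta /z1 normrM normfV (gtr0_norm ssq0) ler_pM2r ?invr_gt0 //.
by have /andP[] := Y_ab i w; have /andP[] := mu_ab; rewrite ler_norml; lra.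
Qed.

Let z1_gt0 : 0 < z1.
Proof. by rewrite divr_gt0 //; have /andP[] := mu_ab; lra. Qed.

Let z1_ge0 : 0 <= z1. Proof. exact: ltW. Qed.

Let M0 := n%:R * z1.

Let W_le w : `|W w| <= M0.
Proof.
rewrite /W /nsum (le_trans (ler_norm_sum _ _ _)) //.
apply: (le_trans (@ler_sum R nat J xpredT (fun i => `|zeta i w|) (fun=> z1) _)) => [i _|].
  exact: zeta_le.
by rewrite big_const_seq count_predT size_iota iter_addr_0 /M0 mulr_natl.
Qed.

Let mzeta i : measurable_fun setT (zeta i).
Proof. by apply: measurable_funM => //; exact: measurable_funB. Qed.

Let psi v w := Num.max (W w - v) 0.
Let mpsi v : measurable_fun setT (psi v).
Proof. by apply: measurable_maxr => //; exact: measurable_funB. Qed.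

Let psi_le v w : `|psi v w| <= M0 + `|v|.
Proof.
have := W_le w; rewrite ler_norml => /andP[w1 w2]; have := ler_norm (- v).
rewrite normrN /psi => nv; have M00 : 0 <= M0 by rewrite mulr_ge0 // ltW.
rewrite ger0_norm ?le_max ?lexx ?orbT // ge_max; apply/andP; split; first by lra.
by rewrite addr_ge0.
Qed.

Let Ipsi v : intg P (psi v).
Proof. exact: intg_bounded (mpsi v) (psi_le v). Qed.

Let IWpsi v : intg P (fun w => W w * psi v w).
Proof.
apply: (@intg_bounded _ _ _ _ _ (M0 * (M0 + `|v|))); first exact: measurable_funM.
by move=> w; rewrite normrM ler_pM.
Qed.

Let mgt v : measurable [set w | v < W w]. Proof. exact: measurable_gt. Qed.
Let mwin v h : measurable [set w | v < W w <= h]. Proof. exact: measurable_window. Qed.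
Let Igt v : intg P (fun w => (v < W w)%R%:R). Proof. exact: intg_pred. Qed.
Let Iwin v h : intg P (fun w => (v < W w <= h)%R%:R). Proof. exact: intg_pred. Qed.
Let IW : intg P W. Proof. exact: intg_bounded mW W_le. Qed.
Let IWgt v : intg P (fun w => W w * (v < W w)%R%:R).
Proof.
apply: (@intg_bounded _ _ _ _ _ M0); first exact: measurable_funM mW (intg_measurable (Igt v)).
move=> w; rewrite normrM (le_trans _ (W_le w)) // ler_piMr //.
by case: (v < W w); rewrite ?normr1 ?normr0.
Qed.

Let r v := Ex P (psi v).
Let G v := Ex P (fun w => W w * psi v w).

(** Differentiability of [r] rests on the continuity of [p], which concentration supplies in
    quantitative form: a kink error of size [|h|] on an event of probability [O(|h|)]. *)
Let dr v : is_derive v 1 r (- p v).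
Proof.
apply: (@is_derive_quadratic_error R _ v _ (2 * Cc)) => h.
have [->|h0] := eqVneq h 0.
  by rewrite addr0 subrr mul0r subrr normr0 expr0n mulr0.
have nh : 0 < `|h| by rewrite normr_gt0.
have -> : r (v + h) - r v - h * - p v =
    Ex P (fun w => psi (v + h) w - psi v w + h * (v < W w)%R%:R).
  rewrite ExD ?ExB ?ExZ ?Ex_pr //; [by rewrite mulrN opprK|exact: intgB|exact: intgZ].
apply: le_trans (Ex_norm _) _; first by apply: intgD; [exact: intgB|exact: intgZ].
apply: (@le_trans _ _ (Ex P (fun w => `|h| * (v - `|h| < W w <= v + `|h|)%R%:R))).
  apply: Ex_le => [||w]; last exact: ramp_error.
    by apply: intg_norm; apply: intgD; [exact: intgB|exact: intgZ].
  exact: intgZ.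
rewrite ExZ // Ex_pr // -(real_normK (num_real h)) expr2 mulrA [leRHS]mulrC.
by rewrite ler_pM2l //; exact: sym_window1.
Qed.

Let dG v : is_derive v 1 G (- (r v + v * p v)).
Proof.
have EWgt : r v + v * p v = Ex P (fun w => W w * (v < W w)%R%:R).
  rewrite /r /p -Ex_pr // -ExZ // -ExD //; last exact: intgZ.
  congr (Ex P _); apply/funext => w; rewrite /psi.
  by case: ltP => vw; rewrite ?mulr1 ?mulr0; [rewrite max_l|rewrite max_r]; lra.
apply: (@is_derive_quadratic_error R _ v _ (2 * Cc * M0)) => h.
have M00 : 0 <= M0 by rewrite mulr_ge0 // ltW.
have [->|h0] := eqVneq h 0.
  by rewrite addr0 subrr mul0r subrr normr0 expr0n mulr0.
have nh : 0 < `|h| by rewrite normr_gt0.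
have Ierr : intg P (fun w => W w * psi (v + h) w - W w * psi v w + h * (W w * (v < W w)%R%:R)).
  by apply: intgD; [exact: intgB|exact: intgZ].
have -> : G (v + h) - G v - h * - (r v + v * p v) =
    Ex P (fun w => W w * psi (v + h) w - W w * psi v w + h * (W w * (v < W w)%R%:R)).
  rewrite EWgt ExD ?ExB ?ExZ //; [by rewrite mulrN opprK|exact: intgB|exact: intgZ].
apply: le_trans (Ex_norm Ierr) _.
apply: (@le_trans _ _ (Ex P (fun w => M0 * `|h| * (v - `|h| < W w <= v + `|h|)%R%:R))).
  apply: Ex_le => [||w]; [exact: intg_norm|exact: intgZ|].
  have -> : W w * psi (v + h) w - W w * psi v w + h * (W w * (v < W w)%R%:R) =
    W w * (psi (v + h) w - psi v w + h * (v < W w)%R%:R) by ring.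
  by rewrite normrM -mulrA ler_pM //; exact: ramp_error.
rewrite ExZ // Ex_pr // -(real_normK (num_real h)).
have := sym_window1 v nh; have : 0 <= M0 * `|h| by rewrite mulr_ge0.
move=> Mh /(ler_wpM2l Mh) => /le_trans; apply.
by rewrite le_eqVlt; apply/orP; left; apply/eqP; ring.
Qed.

Let zfun (x : R) := (x - mu) / (s1 * sq).
Let mzfun : measurable_fun setT zfun.
Proof. by apply: measurable_funM => //; exact: measurable_funB. Qed.

Let Izeta i : intg P (zeta i). Proof. exact: intg_bounded (mzeta i) (zeta_le i). Qed.

Let EY i : Ex P (Y i) = mu.
Proof. exact: (id_Ex Y_id i (@measurable_id _ _ setT) (IY 0)).2. Qed.

Let Ezeta i : Ex P (zeta i) = 0.
Proof.
rewrite /zeta; under eq_fun do rewrite mulrC.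
rewrite ExZ ?ExB ?EY ?Ex_cst ?subrr ?mulr0 //; first exact: intg_cst.
by apply: intgB => //; exact: intg_cst.
Qed.

Let EW : Ex P W = 0.
Proof.
rewrite /W /nsum Ex_sum; last exact: Izeta.
by rewrite big1 // => i _; exact: Ezeta.
Qed.

Let Iz2 : intg P (fun w => zfun (Y 0%N w) ^+ 2).
Proof.
apply: (@intg_bounded _ _ _ _ _ (z1 ^+ 2)) => [|w].
  exact: measurable_funX (mzeta 0).
by rewrite normrX lerXn2r ?nnegrE //; exact: zeta_le.
Qed.

Let Ez2 : Ex P (fun w => zfun (Y 0%N w) ^+ 2) = n%:R^-1.
Proof.
have -> : (fun w => zfun (Y 0%N w) ^+ 2) =
    (fun w => (s1 ^+ 2 * n%:R)^-1 * (Y 0%N w - mu) ^+ 2).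
  by apply/funext => w; rewrite /zfun -sqsq; field; rewrite !gt_eqF.
rewrite ExZ ?varY; first by field; rewrite !gt_eqF.
apply: (@intg_bounded _ _ _ _ _ ((b - a) ^+ 2)) => [|w].
  by apply: measurable_funX; exact: measurable_funB.
rewrite normrX lerXn2r ?nnegrE //.
  by have /andP[] := mu_ab; lra.
by have /andP[] := Y_ab 0%N w; have /andP[] := mu_ab; rewrite ler_norml; lra.
Qed.

Let EW2 : Ex P (fun w => W w ^+ 2) = 1.
Proof.
have [_] := centered_sum_L2 Y_indep Y_id uJ mzfun Iz2 (Ezeta 0).
by rewrite Ez2 size_iota mulfV ?gt_eqF.
Qed.

Let r_right v : M0 <= v -> r v = 0.
Proof.
move=> Mv; rewrite -(Ex_cst P 0); congr (Ex P _); apply/funext => w.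
by rewrite /psi max_r // subr_le0 (le_trans _ Mv) // (le_trans (ler_norm _)).
Qed.

Let G_right v : M0 <= v -> G v = 0.
Proof.
move=> Mv; rewrite -(Ex_cst P 0); congr (Ex P _); apply/funext => w.
by rewrite /psi max_r ?mulr0 // subr_le0 (le_trans _ Mv) // (le_trans (ler_norm _)).
Qed.

Let psi_left v w : v <= - M0 -> psi v w = W w - v.
Proof.
move=> vM; rewrite /psi max_l // subr_ge0 (le_trans vM) //.
by have := W_le w; rewrite ler_norml => /andP[].
Qed.

Let r_left v : v <= - M0 -> r v = - v.
Proof.
move=> vM; rewrite /r (_ : psi v = fun w => W w - v); last first.
  by apply/funext => w; exact: psi_left.
by rewrite ExB ?EW ?Ex_cst ?sub0r //; exact: intg_cst.
Qed.

Let G_left v : v <= - M0 -> G v = 1.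
Proof.
move=> vM; rewrite /G (_ : (fun w => _) = fun w => W w ^+ 2 - v * W w); last first.
  by apply/funext => w; rewrite psi_left //; ring.
rewrite ExB ?ExZ ?EW ?EW2 ?mulr0 ?subr0 //; last exact: intgZ.
apply: (@intg_bounded _ _ _ _ _ (M0 ^+ 2)) => [|w]; first exact: measurable_funX.
have M00 : 0 <= M0 by rewrite mulr_ge0 // ltW.
by rewrite normrX lerXn2r ?nnegrE.
Qed.

Let p_nonincr v w : v <= w -> p w <= p v.
Proof.
move=> vw; apply: pr_le; try exact: mgt.
by move=> x /=; exact: le_lt_trans.
Qed.

Let z1E : z1 = B1 / sq.
Proof. by rewrite /z1 /B1; field; rewrite !gt_eqF. Qed.

Let B1_gt0 : 0 < B1.
Proof. by rewrite divr_gt0 //; have /andP[] := mu_ab; lra. Qed.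

Let Q w := \sum_(i <- J) zeta i w ^+ 2.

Let mQ : measurable_fun setT Q.
Proof. by apply: measurable_sum => i; exact: measurable_funX. Qed.

Let nz1 : n%:R * z1 ^+ 2 = B1 ^+ 2.
Proof. by rewrite z1E -sqsq; field; rewrite gt_eqF. Qed.

(** [Q - 1] is a sum of [n] centred independent terms bounded by [(B1^2 + 1) / n], so its variance
    is at most [(B1^2 + 1)^2 / n]. *)
Let EQ : intg P (fun w => (Q w - 1) ^+ 2) /\
  Num.sqrt (Ex P (fun w => (Q w - 1) ^+ 2)) <= (B1 ^+ 2 + 1) / sq.
Proof.
pose f x := zfun x ^+ 2 - n%:R^-1.
have mf : measurable_fun setT f by apply: measurable_funB => //; exact: measurable_funX.
have ni : 0 <= n%:R^-1 :> R by rewrite invr_ge0 ltW.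
have f_le w : `|f (Y 0%N w)| <= (B1 ^+ 2 + 1) / n%:R.
  rewrite mulrDl mul1r -nz1 mulrAC mulfV ?gt_eqF // mul1r.
  have : zfun (Y 0%N w) ^+ 2 <= z1 ^+ 2.
    by rewrite -[leLHS]ger0_norm ?sqr_ge0 // normrX lerXn2r ?nnegrE //; exact: zeta_le.
  by have := sqr_ge0 (zfun (Y 0%N w)); rewrite /f ler_norml; lra.
have c0 : 0 <= (B1 ^+ 2 + 1) / n%:R by rewrite mulr_ge0 // addr_ge0 // sqr_ge0.
have If2 : intg P (fun w => f (Y 0%N w) ^+ 2).
  apply: (@intg_bounded _ _ _ _ _ (((B1 ^+ 2 + 1) / n%:R) ^+ 2)) => [|w].
    by apply: measurable_funX; exact: measurableT_comp.
  by rewrite normrX lerXn2r ?nnegrE.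
have Ef : Ex P (fun w => f (Y 0%N w)) = 0.
  by rewrite /f ExB ?Ez2 ?Ex_cst ?subrr //; exact: intg_cst.
have [Is Es] := centered_sum_L2 Y_indep Y_id uJ mf If2 Ef.
have QE : (fun w => (Q w - 1) ^+ 2) = (fun w => (\sum_(i <- J) f (Y i w)) ^+ 2).
  apply/funext => w; congr (_ ^+ 2); rewrite /f sumrB; congr (_ - _).
  rewrite big_const_seq count_predT size_iota iter_addr_0.
  by rewrite -[RHS]mulr_natr mulVf ?gt_eqF.
rewrite QE; split => //; rewrite Es size_iota.
have r0 : 0 <= (B1 ^+ 2 + 1) / sq by rewrite divr_ge0 ?addr_ge0 ?sqr_ge0 // ltW.
rewrite -[leRHS]ger0_norm // -sqrtr_sqr ler_wsqrtr //.
have -> : ((B1 ^+ 2 + 1) / sq) ^+ 2 = n%:R * ((B1 ^+ 2 + 1) / n%:R) ^+ 2.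
  by rewrite -sqsq; field; rewrite gt_eqF.
rewrite ler_pM2l // -[leRHS](Ex_cst P); apply: Ex_le => [//||w]; first exact: intg_cst.
by rewrite -(real_normK (num_real (f _))) lerXn2r ?nnegrE.
Qed.

Let leave_one_out i v : i \in J ->
  Ex P (fun w => zeta i w * Num.max (W w - zeta i w - v) 0) = 0.
Proof.
(* [g] writes the ramp of [W - zeta i] as a function of the sum of the other variables; the extra
   [+ mu] restores the centring of the removed one. *)
move=> iJ; pose g y := Num.max ((y - n%:R * mu + mu) / (s1 * sq) - v) 0.
have mg : measurable_fun setT g.
  apply: measurable_maxr => //; apply: measurable_funB => //; apply: measurable_funM => //.
  by apply: measurable_funD => //; exact: measurable_funB.
have gE w : Num.max (W w - zeta i w - v) 0 = g (psum Y (rem i J) w).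
  rewrite /g WE (psum_rem _ w iJ) /zeta; congr (Num.max (_ - _) _).
  by field; rewrite !gt_eqF.
have mR : measurable_fun setT (psum Y (rem i J)) by exact: measurable_psum.
under eq_fun do rewrite gE; rewrite -[RHS](Ex_cst P).
apply: (@indep_Ex_eq _ _ _ P (Y i) (psum Y (rem i J)) (mY i) mR
  (fun z => zfun z.1 * g z.2) (fun=> 0)) => //.
- exact: indep_rem.
- by apply: measurable_funM; exact: measurableT_comp.
- rewrite /=; under eq_fun do rewrite -gE.
  apply: (@intg_bounded _ _ _ _ _ (z1 * (M0 + z1 + `|v|))) => [|w].
    apply: measurable_funM; first exact: mzeta.
    by apply: measurable_maxr => //; apply: measurable_funB => //; exact: measurable_funB.
  rewrite normrM ler_pM //; first exact: zeta_le.
  rewrite ger0_norm ?le_max ?lexx ?orbT // ge_max.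
  have := W_le w; have := zeta_le i w; have := ler_norm (- v); have := normr_ge0 v.
  rewrite normrN !ler_norml; have : 0 <= M0 by rewrite mulr_ge0 // ltW.
  have := z1_ge0; lra.
- exact: intg_cst.
- by move=> y /=; under eq_fun do rewrite mulrC; exact/intgZ/Izeta.
- by move=> y; exact: intg_cst.
move=> y /=; rewrite Ex_cst; under eq_fun do rewrite mulrC.
by rewrite ExZ ?(Ezeta i) ?mulr0 //; exact: Izeta.
Qed.

Let eps := (B1 ^+ 2 + 1 + 2 * B1 ^+ 3 * Cc) / sq.

(** By [leave_one_out], [G v] is the expected sum of [zeta i] times the increment of the ramp caused
    by [zeta i]. To first order this is [Q] on the event [v < W]. Replacing [Q] by 1 costs a
    Cauchy-Schwarz term; the kink error is at most [n z1^2 = B1^2] times a window probability. These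
    are the two parts of [eps]. *)
Let Stein_bound v : `|p v - G v| <= eps * Num.sqrt (p (v - 3 * z1)).
Proof.
pose inc i w := zeta i w * (psi v w - Num.max (W w - zeta i w - v) 0).
have mmax i : measurable_fun setT (fun w => Num.max (W w - zeta i w - v) 0).
  by apply: measurable_maxr => //; apply: measurable_funB => //; exact: measurable_funB.
have Ione i : intg P (fun w => zeta i w * Num.max (W w - zeta i w - v) 0).
  apply: (@intg_bounded _ _ _ _ _ (z1 * (M0 + z1 + `|v|))) => [|w].
    exact: measurable_funM.
  rewrite normrM ler_pM //.
  rewrite ger0_norm ?le_max ?lexx ?orbT // ge_max.
  have := W_le w; have := zeta_le i w; have := ler_norm (- v); have := normr_ge0 v.
  rewrite normrN !ler_norml; have : 0 <= M0 by rewrite mulr_ge0 // ltW.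
  have := z1_ge0; lra.
have Izpsi i : intg P (fun w => zeta i w * psi v w).
  apply: (@intg_bounded _ _ _ _ _ (z1 * (M0 + `|v|))) => [|w].
    exact: measurable_funM.
  by rewrite normrM ler_pM // ?zeta_le ?psi_le.
have Iinc i : intg P (inc i).
  by rewrite /inc; under eq_fun do rewrite mulrBr; exact: intgB.
have GE : G v = Ex P (fun w => \sum_(i <- J) inc i w).
  rewrite Ex_sum // /G /W /nsum; under eq_fun do rewrite mulr_suml.
  rewrite Ex_sum //; apply: eq_big_seq => i iJ.
  rewrite /inc; under [in RHS]eq_fun do rewrite mulrBr.
  by rewrite ExB // leave_one_out // subr0.
have IQgt : intg P (fun w => (Q w - 1) * (v < W w)%R%:R).
  apply: intgM_L2 (proj1 EQ) _.
  - exact: measurable_funB.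
  - exact: intg_measurable.
  - have -> : (fun w => (v < W w)%R%:R ^+ 2) = (fun w => (v < W w)%R%:R) :> (T -> R).
      by apply/funext => w; case: (v < W w); rewrite ?expr1n ?expr0n.
    exact: Igt.
have Isum : intg P (fun w => \sum_(i <- J) inc i w) by exact: intg_sum.
have IQ : intg P (fun w => Q w * (v < W w)%R%:R).
  have := intgD IQgt (Igt v); congr (intg P _); apply/funext => w; ring.
have Idiff : intg P (fun w => \sum_(i <- J) inc i w - Q w * (v < W w)%R%:R).
  exact: intgB.
have split : p v - G v = - Ex P (fun w => (Q w - 1) * (v < W w)%R%:R)
   - Ex P (fun w => \sum_(i <- J) inc i w - Q w * (v < W w)%R%:R).
  have -> : Ex P (fun w => (Q w - 1) * (v < W w)%R%:R) =
      Ex P (fun w => Q w * (v < W w)%R%:R) - p v.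
    rewrite /p -Ex_pr // -ExB //; congr (Ex P _); apply/funext => w; ring.
  by rewrite ExB // -GE; ring.
have le1 : `|Ex P (fun w => (Q w - 1) * (v < W w)%R%:R)| <=
    (B1 ^+ 2 + 1) / sq * Num.sqrt (p v).
  apply: le_trans (Cauchy_Schwarz_pr _ (proj1 EQ) (mgt v)) _.
    exact: measurable_funB.
  by rewrite ler_wpM2r ?sqrtr_ge0 //; exact: proj2 EQ.
have le2 : `|Ex P (fun w => \sum_(i <- J) inc i w - Q w * (v < W w)%R%:R)| <=
    B1 ^+ 2 * (Cc * (2 * z1) * Num.sqrt (p (v - 3 * z1))).
  apply: le_trans (Ex_norm Idiff) _.
  apply: (@le_trans _ _ (Ex P (fun w => B1 ^+ 2 * (v - z1 < W w <= v + z1)%R%:R))).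
    apply: Ex_le => [||w]; [exact: intg_norm|exact: intgZ|].
    rewrite /Q mulr_suml -sumrB -nz1.
    apply: le_trans (ler_norm_sum _ _ _) _.
    apply: (le_trans (@ler_sum R nat J xpredT _
      (fun=> z1 ^+ 2 * (v - z1 < W w <= v + z1)%R%:R) _)) => [i _|]; last first.
      by rewrite big_const_seq count_predT size_iota iter_addr_0 -[_ *+ n]mulr_natl mulrA.
    rewrite /inc expr2 -mulrA -mulrBr normrM expr2 -mulrA ler_pM //.
    apply: le_trans (ramp_increment_error _ _ (zeta_le i w)) _.
    by rewrite ler_wpM2r //; exact: zeta_le.
  by rewrite ExZ // Ex_pr // ler_wpM2l ?sqr_ge0 //; exact: sym_window.
have shift : Num.sqrt (p v) <= Num.sqrt (p (v - 3 * z1)).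
  by rewrite ler_wsqrtr // p_nonincr //; have := z1_ge0; lra.
rewrite split; apply: le_trans (ler_normB _ _) _; rewrite normrN.
apply: le_trans (lerD le1 le2) _.
have c0 : 0 <= (B1 ^+ 2 + 1) / sq by rewrite divr_ge0 ?addr_ge0 ?sqr_ge0 // ltW.
apply: le_trans (lerD (ler_wpM2l c0 shift) (lexx _)) _.
by rewrite le_eqVlt; apply/orP; left; apply/eqP; rewrite /eps z1E; ring.
Qed.

(** This is [sqrt n] times [12 eps + 3 delta], with [delta = 3 z1]. *)
Definition nsum_const := 12 * (((b - a + 1) / s1) ^+ 2 + 1 +
  2 * ((b - a + 1) / s1) ^+ 3 * conc_const) + 9 * ((b - a + 1) / s1).

Lemma nsum_close v :
  `|Num.sqrt (pr P [set w | v < nsum w]) - Num.sqrt (Phic v)| <= nsum_const / Num.sqrt n%:R.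
Proof.
have eps0 : 0 <= eps.
  have B3 : 0 <= B1 ^+ 3 by rewrite exprn_ge0 // ltW.
  apply: divr_ge0; last exact: ltW.
  by have := sqr_ge0 B1; have := mulr_ge0 B3 Cc_ge0; nra.
have z30 : 0 <= 3 * z1 by rewrite mulr_ge0.
have := @Stein_comparison R p r G M0 eps (3 * z1) p_ge0 p_le1 p_nonincr dr dG r_right G_right
  r_left G_left eps0 z30 Stein_bound v.
move=> /le_trans; apply; rewrite le_eqVlt; apply/orP; left; apply/eqP.
by rewrite /eps z1E /nsum_const -/sq -/B1 -/Cc; ring.
Qed.

End NormalizedSum.

(** * From the sum to the U-statistic *)

Section Perturbation.
Context {R : realType}.
Implicit Types u x y h : R.
Local Notation q := (@Phic R).
Local Notation sq u := (Num.sqrt (q u)).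

Lemma sqrt_Phic_nonincr x y : x <= y -> sq y <= sq x.
Proof. by move=> xy; rewrite ler_wsqrtr // Phic_nonincr. Qed.

Lemma sqrt_Phic_lip u x y : x <= y ->
  (forall v, x <= v <= y -> 1 + u ^+ 2 <= 4 * (1 + v ^+ 2)) ->
  sq x <= sq y + 32 / (1 + u ^+ 2) * (y - x).
Proof.
move=> xy far; pose K := 32 / (1 + u ^+ 2).
suff : sq x + K * x <= sq y + K * y by rewrite -/K; lra.
apply: (@is_derive_le R (fun t => sq t + K * t)
         (fun t => - (gauss t / (2 * sq t)) + K) _ _ xy) => v vxy.
  apply: is_derive_conv (is_derive_addf (is_derive_sqrt_Phic v)
    (is_derive_mulf (is_derive_cstf K v) (is_derive_idf v))) _.
  by ring.
have := sqrt_Phic_slope v; have v0 := add1sqr_gt0 v; have u0 := add1sqr_gt0 u.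
have : 8 / (1 + v ^+ 2) <= K.
  by rewrite /K ler_pdivrMr // mulrAC ler_pdivlMr //; have := far v vxy; lra.
lra.
Qed.

(* The slope of [sqrt Phic] decays like [1 / (1 + u^2)], so it absorbs a quadratic shift. *)
Lemma sqrt_Phic_perturb u x h : 0 <= h <= 4^-1 -> h * `|u| <= 4^-1 ->
  `|x - u| <= h * (1 + u ^+ 2) -> `|sq x - sq u| <= 32 * h.
Proof.
move=> /andP[h0 h4] hu xu; have u0 := add1sqr_gt0 u.
(* The displacement [h (1 + u^2)] is at most [1/2] when [|u| <= 1] and at most [|u| / 2] otherwise.
   Either way [1 + v^2] keeps a quarter of [1 + u^2] along the whole segment. *)
have near1 : h * (1 + u ^+ 2) <= 2^-1 \/ 1 <= `|u| /\ h * (1 + u ^+ 2) <= `|u| / 2.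
  have u2 : u ^+ 2 = `|u| ^+ 2 by rewrite real_normK ?num_real.
  have un := normr_ge0 u.
  rewrite u2; move: `|u| un hu => c c0 hc.
  have [c1|c1] := leP c 1; [left|right; split; first exact: ltW].
    have c2 : c ^+ 2 <= 1 by rewrite exprn_ile1.
    have := ler_wpM2l h0 c2; lra.
  have := ler_wpM2r c0 hc; have : 0 <= h * (c ^+ 2 - 1).
    by rewrite mulr_ge0 // subr_ge0 exprn_ege1 // ltW.
  rewrite expr2; lra.
have far v : `|v - u| <= h * (1 + u ^+ 2) -> 1 + u ^+ 2 <= 4 * (1 + v ^+ 2).
  move=> vu; have v2 : v ^+ 2 = `|v| ^+ 2 by rewrite real_normK ?num_real.
  have u2 : u ^+ 2 = `|u| ^+ 2 by rewrite real_normK ?num_real.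
  have := ler_normB v (v - u); rewrite opprB addrC subrK => uv.
  have vn := normr_ge0 v; have un := normr_ge0 u.
  rewrite v2 u2; move: `|v| `|u| vn un uv near1 => e c e0 c0 ce near1.
  case: near1 => [n1|[u1 n1]].
    have {}ce : c <= e + 2^-1 by lra.
    have : c ^+ 2 <= (e + 2^-1) ^+ 2 by rewrite lerXn2r ?nnegrE //; lra.
    by have := sqr_ge0 (e - 1); have := sqr_ge0 e; lra.
  have {}ce : c <= 2 * e by lra.
  have : c ^+ 2 <= (2 * e) ^+ 2 by rewrite lerXn2r ?nnegrE //; lra.
  by lra.
have bound y : 0 <= y -> y <= h * (1 + u ^+ 2) -> 32 / (1 + u ^+ 2) * y <= 32 * h.
  by move=> y0 yh; rewrite mulrAC ler_pdivrMr // -mulrA ler_pM2l.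
have [xu0|ux0] := leP x u.
  have d : u - x <= h * (1 + u ^+ 2) by rewrite ler0_norm in xu; lra.
  have := @sqrt_Phic_lip u x u xu0; rewrite ger0_norm ?subr_ge0 ?sqrt_Phic_nonincr //.
  have ux : 0 <= u - x by lra.
  have := bound _ ux d => B L; rewrite lerBlDl (le_trans (L _)) ?lerD2l //.
  by move=> v /andP[xv vu]; apply: far; rewrite ler_norml; lra.
have d : x - u <= h * (1 + u ^+ 2) by rewrite gtr0_norm in xu; lra.
have := @sqrt_Phic_lip u u x (ltW ux0).
rewrite distrC ger0_norm ?subr_ge0 ?sqrt_Phic_nonincr //; last exact: ltW.
have ux : 0 <= x - u by lra.
have := bound _ ux d => B L; rewrite lerBlDl (le_trans (L _)) ?lerD2l //.
by move=> v /andP[xv vu]; apply: far; rewrite ler_norml; lra.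
Qed.

Lemma Phic_tail t : 1 <= t -> q t <= 108 / t ^+ 2.
Proof.
move=> t1; have t0 : 0 < t by lra.
have q0 := Phic_gt0 t; have p0 := gauss_gt0 t.
rewrite ler_pdivlMr ?exprn_gt0 //.
have := Phic_Mills t; have := gauss_decay1 t; nra.
Qed.

Lemma sqrt_Phic_tail t : 1 <= t -> sq t <= 11 / t.
Proof.
move=> t1; have t0 : 0 < t by lra.
have r0 : 0 <= 11 / t by rewrite divr_ge0 // ltW.
rewrite -[leRHS]ger0_norm // -sqrtr_sqr ler_wsqrtr //.
apply: le_trans (Phic_tail t1) _; rewrite exprMn exprVn ler_pM2r ?invr_gt0 ?exprn_gt0 //.
lra.
Qed.

Lemma sqrt_Phic_left t : 1 <= t -> 1 - 108 / t <= sq (- t).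
Proof.
move=> t1; have t0 : 0 < t by lra.
have : q (- t) <= sq (- t).
  have q0 := ltW (Phic_gt0 (- t)); rewrite -{1}(sqr_sqrtr q0) expr2 ler_piMr ?sqrtr_ge0 //.
  by rewrite -[leRHS]sqrtr1 ler_wsqrtr // ltW // Phic_lt1.
apply: le_trans; rewrite PhicN.
have := Phic_tail t1; rewrite /Phic => qt.
have : 108 / t ^+ 2 <= 108 / t.
  by rewrite ler_pM2l // lef_pV2 ?posrE ?exprn_gt0 // expr2 ler_peMl // ltW.
lra.
Qed.

(** The quadratic displacement is under control only while [h |u|] is at most [1/4]. Beyond
    [t = 1 / (4 h)], monotonicity compares with the value at [t] or [- t], where [sqrt Phic] is
    within [11 / t] of 0 or [108 / t] of 1. The worst total is [32 h + 432 h], below [500 h]. *)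
Lemma sqrt_close_transfer (F p : R -> R) (lo hi : R -> R) (D h : R) :
  (forall u, 0 <= F u <= 1) -> (forall u v, u <= v -> F v <= F u) ->
  (forall u, `|Num.sqrt (p u) - sq u| <= D) -> 0 < h <= 4^-1 ->
  (forall u, p (lo u) <= F u) -> (forall u, F u <= p (hi u)) ->
  (forall u, `|lo u - u| <= h * (1 + u ^+ 2)) ->
  (forall u, `|hi u - u| <= h * (1 + u ^+ 2)) ->
  forall u, `|Num.sqrt (F u) - sq u| <= D + 500 * h.
Proof.
move=> F01 Fmono pD /andP[h0 h4] Flo Fhi lo_u hi_u.
pose t := (4 * h)^-1.
have th : h * t = 4^-1 by rewrite /t; field; rewrite gt_eqF.
have t0 : 0 < t by rewrite invr_gt0 mulr_gt0.
have t1 : 1 <= t by rewrite invf_ge1 ?mulr_gt0 //; lra.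
have tV : t^-1 = 4 * h by rewrite invrK.
have core u : `|u| <= t -> `|Num.sqrt (F u) - sq u| <= D + 32 * h.
  move=> ut; have hu : h * `|u| <= 4^-1 by rewrite -th ler_pM2l.
  have hh : 0 <= h <= 4^-1 by rewrite (ltW h0).
  have := sqrt_Phic_perturb hh hu (lo_u u); have := sqrt_Phic_perturb hh hu (hi_u u).
  have := pD (lo u); have := pD (hi u).
  have : Num.sqrt (F u) <= Num.sqrt (p (hi u)) by rewrite ler_wsqrtr.
  have : Num.sqrt (p (lo u)) <= Num.sqrt (F u) by rewrite ler_wsqrtr.
  rewrite !ler_norml; lra.
have F1 u : Num.sqrt (F u) <= 1.
  by rewrite -[leRHS]sqrtr1 ler_wsqrtr //; have /andP[] := F01 u.
have q1 u : sq u <= 1 by rewrite -[leRHS]sqrtr1 ler_wsqrtr // ltW // Phic_lt1.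
have D0 : 0 <= D by apply: le_trans (pD 0).
move=> u; have [ut|tu] := leP `|u| t; first by apply: le_trans (core u ut) _; lra.
have tt : `|t| <= t by rewrite gtr0_norm.
have Ntt : `|- t| <= t by rewrite normrN gtr0_norm.
have [u0|u0] := leP 0 u.
  have tu' : t <= u by rewrite -(ger0_norm u0) ltW.
  have : Num.sqrt (F u) <= Num.sqrt (F t) by rewrite ler_wsqrtr // Fmono.
  have := sqrt_Phic_nonincr tu'; have := core t tt; have := sqrt_Phic_tail t1.
  have := sqrtr_ge0 (F u); have := sqrtr_ge0 (q u).
  rewrite tV !ler_norml; lra.
have tu' : u <= - t by rewrite ltr0_norm // in tu; lra.
have : Num.sqrt (F (- t)) <= Num.sqrt (F u) by rewrite ler_wsqrtr // Fmono.
have := sqrt_Phic_nonincr tu'; have := core (- t) Ntt; have := sqrt_Phic_left t1.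
have := F1 u; have := q1 u.
rewrite tV !ler_norml; lra.
Qed.

(** The condition [- 1 <= 2 c W] places [W] on the increasing branch of [x + c x^2], where this map
    can be inverted up to a quadratic correction. *)
Lemma quadratic_inversion (c W w : R) : 0 <= c -> - 1 <= 2 * c * W ->
  w < W + c * W ^+ 2 -> w - 4 * c * w ^+ 2 < W.
Proof.
move=> c0 cW; rewrite !ltNge; apply: contra => Wx.
have w2 : 0 <= c * w ^+ 2 by rewrite mulr_ge0 ?sqr_ge0.
have [W0|W0] := leP 0 W; first by have : W ^+ 2 <= w ^+ 2; nra.
have half : W + c * W ^+ 2 <= W / 2 by nra.
have [w0|w0] := leP 0 w; first by lra.
(* If [W <= 2 w], the bound [W / 2] suffices. Otherwise [2 w < W < 0] gives [W^2 <= 4 w^2], the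
   source of the factor 4. *)
have [Ww|wW] := leP W (2 * w); first by lra.
have : W ^+ 2 <= 4 * w ^+ 2 by nra.
by move=> /(ler_wpM2l c0); lra.
Qed.

End Perturbation.

Lemma sum_offdiag {R : comPzRingType} (n : nat) (y : 'I_n -> R) (c : R) :
  \sum_(i < n) \sum_(j < n | j != i) (y i * y j - c) =
  (\sum_(i < n) y i) ^+ 2 - \sum_(i < n) y i ^+ 2 - n%:R * n%:R * c + n%:R * c.
Proof.
have inner i : \sum_(j < n | j != i) (y i * y j - c) =
    y i * (\sum_(j < n) y j) - y i ^+ 2 - n%:R * c + c.
  have -> : \sum_(j < n | j != i) (y i * y j - c) =
    \sum_(j < n) (y i * y j - c) - (y i * y i - c).
    by rewrite [X in _ = X - _](bigD1 i) //=; ring.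
  by rewrite sumrB -mulr_sumr sumr_const card_ord -[c *+ n]mulr_natl; ring.
rewrite (eq_bigr _ (fun i _ => inner i)) !big_split /= !sumrN -mulr_suml.
by rewrite !sumr_const card_ord -[c *+ n]mulr_natl -[(_ * c) *+ n]mulr_natl; ring.
Qed.

(** * The U-statistic as a quadratic function of the normalized sum *)

Section UstatBounded.
Context d (T : measurableType d) (R : realType) (P : probability T R).
Variables (Y : nat -> {RV P >-> R}) (s : R -> R) (a b s1 : R).
Implicit Types u v h x : R.
Hypothesis Y_indep : mutually_independent Y.
Hypothesis Y_id : identically_distributed Y.
Hypothesis a_gt0 : 0 < a.
Hypothesis Y_ab : forall i w, a <= Y i w <= b.
Hypothesis s_meas : measurable_fun setT s.
Hypothesis s_L2 : intg P (fun w => s (Y 0%N w) ^+ 2).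
Hypothesis s_ibp : forall v h M L, 0 < h -> 0 < L ->
  Ex P (fun w => s (Y 0%N w) * testfun v h M L (Y 0%N w)) =
  - Ex P (fun w => testfun' v h M L (Y 0%N w)).
Hypothesis s1_gt0 : 0 < s1.
Let mu := Ex P (Y 0%N).
Hypothesis varY : Ex P (fun w => (Y 0%N w - mu) ^+ 2) = s1 ^+ 2.

Definition Ustat_c (n : nat) (w : T) : R := (Num.sqrt n%:R * (n%:R - 1))^-1 *
  \sum_(i < n) \sum_(j < n | j != i) (Y i w * Y j w - Ex P (Y 0%N) ^+ 2).

Let mY i : measurable_fun setT (Y i : T -> R). Proof. exact: measurable_RV. Qed.

Let mu_ab : a <= mu <= b.
Proof.
have IY : intg P (Y 0%N).
  apply: (@intg_bounded _ _ _ _ _ b) => // w.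
  by have := a_gt0; have /andP[] := Y_ab 0%N w; rewrite ler_norml; lra.
rewrite -[a](Ex_cst P) -[b](Ex_cst P); apply/andP; split; apply: Ex_le => //;
  try exact: intg_cst; by move=> w; have /andP[] := Y_ab 0%N w.
Qed.

Let mu0 : 0 < mu. Proof. by have := a_gt0; have /andP[] := mu_ab; lra. Qed.
Let sigma := 2 * mu * s1.
Let c := s1 / (2 * mu).
Let k := b ^+ 2 / sigma.
Let sigma0 : 0 < sigma. Proof. by rewrite !mulr_gt0. Qed.
Let c0 : 0 < c. Proof. by rewrite divr_gt0 // mulr_gt0. Qed.
Let k0 : 0 <= k. Proof. by rewrite divr_ge0 ?sqr_ge0 // ltW. Qed.

(** The contributions to the displacement of the threshold: 1 for the factor [1 - 1/n], [k] for the
    diagonal remainder, and [8 c (1 + k^2)] for the quadratic correction [4 c w^2] with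
    [w^2 <= 2 (1 + k^2) (1 + u^2)]. *)
Definition Ustat_const := 1 + b ^+ 2 / (2 * Ex P (Y 0%N) * s1) +
  8 * (s1 / (2 * Ex P (Y 0%N))) * (1 + (b ^+ 2 / (2 * Ex P (Y 0%N) * s1)) ^+ 2).
Let K := Ustat_const.

Variable n : nat.
Hypothesis n_gt1 : (1 < n)%N.
Let sq := Num.sqrt (n%:R : R).
Let W := @nsum _ _ _ P Y s1 n.
Let n0 : 0 < (n%:R : R). Proof. by rewrite ltr0n ltnW. Qed.
Let n1 : 0 < (n%:R - 1 : R). Proof. by rewrite subr_gt0 ltr1n. Qed.
Let sq0 : 0 < sq. Proof. by rewrite sqrtr_gt0. Qed.
Let sqsq : sq ^+ 2 = n%:R. Proof. by rewrite sqr_sqrtr // ltW. Qed.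
Let sq1 : 1 <= sq. Proof. by rewrite -sqrtr1 ler_wsqrtr // ler1n ltnW. Qed.

Let S w := \sum_(i < n) Y i w.
Let Q w := \sum_(i < n) Y i w ^+ 2.
Let rest w := (n%:R * mu ^+ 2 - Q w) / (sq * n%:R * sigma).

Let SW w : S w = n%:R * mu + s1 * sq * W w.
Proof.
rewrite /W /nsum -mulr_suml -/mu -/sq.
have -> : \sum_(i <- iota 0 n) (Y i w - mu) = \sum_(i < n) (Y i w - mu).
  by rewrite -(big_mkord xpredT (fun i => Y i w - mu)) /index_iota subn0.
by rewrite sumrB sumr_const card_ord -[mu *+ n]mulr_natl -/(S w); field; rewrite !gt_eqF.
Qed.

(** Expand [S^2] with [S = n mu + s1 sqrt n W]: the cross term yields [sigma W], the square yields
    the term in [c], and [rest] collects the diagonal [Q] against its counterpart [n mu^2] from the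
    centring. *)
Let UE w : Ustat_c n w = sigma * (n%:R / (n%:R - 1)) *
  (W w + c / sq * W w ^+ 2 + rest w).
Proof.
rewrite /Ustat_c sum_offdiag -/mu -/sq -/(S w) -/(Q w) SW /rest /c /sigma -sqsq.
by field; rewrite sqsq !gt_eqF.
Qed.

Let rest_le w : `|rest w| <= k / sq.
Proof.
have -> : k / sq = n%:R * b ^+ 2 / (sq * n%:R * sigma).
  by rewrite /k; field; rewrite !gt_eqF.
have d0 : 0 < sq * n%:R * sigma by rewrite !mulr_gt0.
rewrite /rest normrM normfV (gtr0_norm d0) ler_pM2r ?invr_gt0 //.
have Y0 i : 0 <= Y i w by have /andP[] := Y_ab i w; have := a_gt0; lra.
have b0 : 0 <= b by have /andP[] := mu_ab; have := a_gt0; lra.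
have Q0 : 0 <= Q w by apply: sumr_ge0 => i _; exact: sqr_ge0.
have Qb : Q w <= n%:R * b ^+ 2.
  rewrite mulr_natl -[n in _ *+ n]card_ord -sumr_const ler_sum // => i _.
  by rewrite lerXn2r ?nnegrE //; have /andP[] := Y_ab i w.
have m0 : 0 <= n%:R * mu ^+ 2 by rewrite mulr_ge0 ?sqr_ge0 // ltW.
have mb : n%:R * mu ^+ 2 <= n%:R * b ^+ 2.
  by rewrite ler_pM2l // lerXn2r ?nnegrE ?(ltW mu0) //; have /andP[] := mu_ab.
by rewrite ler_norml; apply/andP; split; lra.
Qed.

Let gtE u w : (sigma * u < Ustat_c n w) =
  (u * (1 - n%:R^-1) < W w + c / sq * W w ^+ 2 + rest w).
Proof.
have -> : u * (1 - n%:R^-1) = u * ((n%:R - 1) / n%:R) by field; rewrite gt_eqF.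
have r0 : 0 < n%:R / (n%:R - 1) :> R by rewrite divr_gt0.
rewrite UE -mulrA ltr_pM2l // -[RHS](ltr_pM2l r0); congr (_ < _).
by field; rewrite !gt_eqF.
Qed.

Let lo u := u * (1 - n%:R^-1) + k / sq.
Let hi u := u * (1 - n%:R^-1) - k / sq - 4 * (c / sq) * (u * (1 - n%:R^-1) - k / sq) ^+ 2.
Let h := K / sq.

Let mW : measurable_fun setT W.
Proof.
by apply: measurable_sum => i; apply: measurable_funM => //; exact: measurable_funB.
Qed.

Let mU : measurable_fun setT (Ustat_c n).
Proof.
apply: measurable_funM => //; apply: measurable_sum => i.
under eq_fun do rewrite big_mkcond; apply: measurable_sum => j.
case: (j != i) => //=; apply: measurable_funB => //; exact: measurable_funM.
Qed.

Let F u := pr P [set w | sigma * u < Ustat_c n w].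
Let p v := pr P [set w | v < W w].

Let lo_le u : p (lo u) <= F u.
Proof.
apply: pr_le; try exact: measurable_gt.
move=> w /=; rewrite gtE /lo => uW; have := rest_le w; rewrite ler_norml => /andP[r1 _].
have : 0 <= c / sq * W w ^+ 2 by rewrite mulr_ge0 ?sqr_ge0 // divr_ge0 // ltW.
lra.
Qed.

Let hi_ge u : F u <= p (hi u).
Proof.
apply: pr_le; try exact: measurable_gt.
move=> w /=; rewrite gtE /hi => uW; apply: quadratic_inversion.
- by rewrite divr_ge0 // ltW.
(* The branch condition [- 1 <= 2 (c / sq) W] is equivalent to [S w >= 0]; positivity of the
   variables enters here. *)
- have S0 : 0 <= S w.
    by apply: sumr_ge0 => i _; have /andP[] := Y_ab i w; have := a_gt0; lra.
  have -> : 2 * (c / sq) * W w = s1 * sq * W w / (n%:R * mu).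
    by rewrite /c -sqsq; field; rewrite !gt_eqF.
  by rewrite ler_pdivlMr ?mulr_gt0 //; move: S0; rewrite SW; lra.
- by have := rest_le w; rewrite ler_norml => /andP[_ r2]; lra.
Qed.

Let nV : (0 : R) <= n%:R^-1 <= sq^-1.
Proof.
by rewrite invr_ge0 (ltW n0) /= lef_pV2 ?posrE // -sqsq expr2 ler_peMl // ltW.
Qed.

Let abs_le u : `|u| <= 1 + u ^+ 2.
Proof.
rewrite -(real_normK (num_real u)); have := sqr_ge0 (`|u| - 1).
by have := normr_ge0 u; lra.
Qed.

Let base u : `|u * (1 - n%:R^-1) - u| + k / sq <= (1 + k) / sq * (1 + u ^+ 2).
Proof.
have /andP[v0 v1] := nV; have sv : 0 < sq^-1 by rewrite invr_gt0.
have -> : u * (1 - n%:R^-1) - u = - (u * n%:R^-1) by ring.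
rewrite normrN normrM (ger0_norm v0).
have : `|u| * n%:R^-1 <= (1 + u ^+ 2) * sq^-1 by rewrite ler_pM.
have : k * sq^-1 * 1 <= k * sq^-1 * (1 + u ^+ 2).
  by apply: ler_wpM2l; [rewrite mulr_ge0 // ltW|rewrite lerDl sqr_ge0].
by rewrite mulr1; lra.
Qed.

Let Kge : (1 + k) / sq <= h.
Proof.
rewrite /h ler_pM2r ?invr_gt0 // /K /Ustat_const -/mu -/sigma -/k -/c.
have cc := ltW c0; have kk : 0 <= 1 + k ^+ 2 by rewrite addr_ge0 // sqr_ge0.
by rewrite lerDl; apply: mulr_ge0 kk; exact: mulr_ge0.
Qed.

Let lo_close u : `|lo u - u| <= h * (1 + u ^+ 2).
Proof.
apply: (@le_trans _ _ ((1 + k) / sq * (1 + u ^+ 2))); last first.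
  by rewrite ler_wpM2r // ?ltW ?add1sqr_gt0.
apply: le_trans (base u); rewrite /lo addrAC (le_trans (ler_normD _ _)) // lerD2l.
by rewrite ger0_norm // divr_ge0 // ltW.
Qed.

Let hi_close u : `|hi u - u| <= h * (1 + u ^+ 2).
Proof.
pose w := u * (1 - n%:R^-1) - k / sq.
have ks : 0 <= k / sq by rewrite divr_ge0 // ltW.
have wu : `|w - u| <= (1 + k) / sq * (1 + u ^+ 2).
  apply: le_trans (base u); rewrite /w addrAC (le_trans (ler_normB _ _)) // lerD2l.
  by rewrite ger0_norm.
have /andP[v0 v1] := nV.
have ks1 : k / sq <= k by rewrite ler_pdivrMr // ler_peMr.
have nV1 : n%:R^-1 <= 1 :> R by rewrite invf_le1 // ler1n ltnW.
have w_le : `|w| <= `|u| + k.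
  rewrite /w (le_trans (ler_normB _ _)) // lerD //; last by rewrite ger0_norm.
  by rewrite normrM ler_piMr // ger0_norm; lra.
have w2 : w ^+ 2 <= 2 * (1 + k ^+ 2) * (1 + u ^+ 2).
  rewrite -(real_normK (num_real w)).
  apply: (@le_trans _ _ ((`|u| + k) ^+ 2)).
    by rewrite lerXn2r ?nnegrE // addr_ge0.
  rewrite -(real_normK (num_real u)).
  have := sqr_ge0 (`|u| - k); have := mulr_ge0 (sqr_ge0 k) (sqr_ge0 `|u|).
  lra.
have cs : 0 <= 4 * (c / sq) by rewrite mulr_ge0 // divr_ge0 // ltW.
have := ler_wpM2l cs w2; have cw : 0 <= 4 * (c / sq) * w ^+ 2 by rewrite mulr_ge0 ?sqr_ge0.
move=> cw2; rewrite /hi -/w addrAC (le_trans (ler_normB _ _)) // (ger0_norm cw).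
apply: le_trans (lerD wu cw2) _.
rewrite le_eqVlt; apply/orP; left; apply/eqP.
by rewrite /h /K /Ustat_const -/mu -/sigma -/k -/c; ring.
Qed.

Lemma Ustat_c_close u : Ustat_const / Num.sqrt n%:R <= 4^-1 ->
  `|Num.sqrt (pr P [set w | 2 * Ex P (Y 0%N) * s1 * u < Ustat_c n w]) - Num.sqrt (Phic u)|
    <= (nsum_const Y s a b s1 + 500 * Ustat_const) / Num.sqrt n%:R.
Proof.
move=> h4; have h0 : 0 < h.
  by apply: lt_le_trans Kge; rewrite divr_gt0 // ltr_wpDr.
have F01 v : 0 <= F v <= 1.
  by rewrite pr_ge0 pr_le1 //; exact: measurable_gt.
have Fmono v w : v <= w -> F w <= F v.
  move=> vw; apply: pr_le; try exact: measurable_gt.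
  by move=> x /=; apply: le_lt_trans; rewrite ler_pM2l.
have pD := nsum_close Y_indep Y_id Y_ab s_meas s_L2 s_ibp s1_gt0 varY (ltnW n_gt1).
have hh : 0 < h <= 4^-1 by rewrite h0.
have := sqrt_close_transfer F01 Fmono pD hh lo_le hi_ge lo_close hi_close u.
by move=> /le_trans; apply; rewrite le_eqVlt; apply/orP; left; apply/eqP; rewrite /h /K; ring.
Qed.

End UstatBounded.

(** * Passage from almost sure to pointwise bounds, and assembly *)

Section AlmostEverywhere.
Context d (T : measurableType d) (R : realType) (P : probability T R).

Lemma Ex_ae (f g : T -> R) : measurable_fun setT f -> measurable_fun setT g ->
  {ae P, forall w, f w = g w} -> Ex P f = Ex P g.
Proof.
move=> mf mg fg; rewrite /Ex /Rintegral; congr fine; apply: ae_eq_integral => //.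
- exact/measurable_EFinP.
- exact/measurable_EFinP.
- by apply: filterS fg => w fgw _; rewrite /= fgw.
Qed.

Lemma intg_ae (f g : T -> R) : measurable_fun setT f -> measurable_fun setT g ->
  {ae P, forall w, f w = g w} -> intg P f -> intg P g.
Proof.
move=> mf mg fg /integrableP[_ If]; apply/integrableP; split; first exact/measurable_EFinP.
rewrite (@ae_eq_integral _ _ _ P setT (fun w => `|(f w)%:E|%E)) //.
- by apply: measurableT_comp => //; exact/measurable_EFinP.
- by apply: measurableT_comp => //; exact/measurable_EFinP.
- by apply: filterS fg => w fgw _; rewrite /= fgw.
Qed.

Lemma pr_ae (A B : T -> bool) : measurable [set w | A w] -> measurable [set w | B w] ->
  {ae P, forall w, A w = B w} -> pr P [set w | A w] = pr P [set w | B w].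
Proof.
move=> mA mB AB; rewrite -!Ex_pr //.
apply: Ex_ae; [exact: intg_measurable (intg_pred _ mA)|exact: intg_measurable (intg_pred _ mB)|].
by apply: filterS AB => w ->.
Qed.

Lemma ae_forall_nat (A : nat -> T -> Prop) :
  (forall i, {ae P, forall w, A i w}) -> {ae P, forall w, forall i, A i w}.
Proof.
move=> AE; have := negligible_bigcup AE; apply: negligibleS => w /= nA.
by apply: contrapT => H; apply: nA => i; apply: contrapT => nAi; apply: H; exists i.
Qed.

End AlmostEverywhere.

Section Clipping.
Context d (T : measurableType d) (R : realType) (P : probability T R).
Variables (a b : R).

(* Clipping changes each [X i] on a null set only, and makes it bounded everywhere. *)
Definition clip (x : R) : R := Num.min (Num.max x a) (Num.max a b).

(** The ceiling is [Num.max a b] because [a <= b] is not assumed; with ceiling [b] the minimum could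
    fall below [a]. *)
Lemma clip_itv x : a <= clip x <= Num.max a b.
Proof. by rewrite /clip ge_min lexx orbT le_min !le_max !lexx !orbT. Qed.

Lemma clip_id x : a <= x <= b -> clip x = x.
Proof.
move=> /andP[ax xb]; rewrite /clip max_l // min_l // le_max xb orbT //.
Qed.

Lemma measurable_clip : measurable_fun setT clip.
Proof. by apply: measurable_minr => //; exact: measurable_maxr. Qed.

Definition clip_RV (X : {RV P >-> R}) : {RV P >-> R} :=
  mfun_Sub (mem_set (measurableT_comp measurable_clip (measurable_funPT X))).

Variable X : nat -> {RV P >-> R}.

Lemma clip_indep : mutually_independent X ->
  mutually_independent (fun i => clip_RV (X i)).
Proof.
move=> XI J B uJ mB; apply: (XI J (fun i => clip @^-1` B i) uJ) => i.
by rewrite -[X in measurable X]setTI; exact: measurable_clip.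
Qed.

Lemma clip_id_distrib : identically_distributed X ->
  identically_distributed (fun i => clip_RV (X i)).
Proof.
move=> Xid i j B mB; apply: (Xid i j (clip @^-1` B)).
by rewrite -[X in measurable X]setTI; exact: measurable_clip.
Qed.

(** Almost sure boundedness is given for [X 0] alone; equality of laws carries the null event to
    each index, and countably many null sets are then united. *)
Lemma clip_ae : identically_distributed X -> {ae P, forall w, a <= X 0%N w <= b} ->
  {ae P, forall w, forall i, clip_RV (X i) w = X i w}.
Proof.
move=> Xid Xab; apply: ae_forall_nat => i.
have mI : measurable (~` `[a, b]%classic : set R) by apply: measurableC; exact: measurable_itv.
have mXI k : measurable (X k @^-1` (~` `[a, b]%classic)).
  by rewrite -[X in measurable X]setTI; exact: measurable_funPT.
have X0 : P (X 0%N @^-1` (~` `[a, b]%classic)) = 0.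
  apply: measure_negligible => //; exact: negligibleS Xab.
have Xi : P.-negligible (X i @^-1` (~` `[a, b]%classic)).
  by apply/negligibleP => //; rewrite -X0; exact: Xid.
apply: negligibleS Xi => w /= H; rewrite in_itv /=; apply: contra_not H.
exact: clip_id.
Qed.

End Clipping.

Theorem theorem2p8 (R : realType) (d : measure_display)
    (Omega : measurableType d) (P : probability Omega R)
    (X : nat -> {RV P >-> R}) (s : R -> R) (a b sigma : R)
    (X_indep : mutually_independent X)
    (X_id : identically_distributed X)
    (s_score : is_score (X 0%N) s)
    (s_L4 : Lp (X 0%N) 4 s)
    (a_gt0 : 0 < a)
    (X_ab : {ae P, forall w, a <= X 0%N w <= b})
    (sigma2E : sigma ^+ 2 = 4 * fine 'E_P[X 0%N]%E ^+ 2 * fine 'V_P[X 0%N]%E)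
    (sigma_gt0 : 0 < sigma) :
  lessapprox
    (fun (n : nat) (u : R) =>
       `| Num.sqrt (fine (P [set w | sigma * u < Ustat X n w]))
          - Num.sqrt (Phic u) |)
    (fun n : nat =>
       ln n%:R / Num.sqrt n%:R
       * (Num.sqrt 2 * fine 'E_P[fun w => (X 0%N w ^+ 4)%R]%E / sigma ^+ 2)
       * (8 * Num.sqrt 2 + 2)).
Proof.
pose Y i := clip_RV a b (X i).
have XY := clip_ae X_id X_ab.
have Y_ab i w : a <= Y i w <= Num.max a b by exact: clip_itv.
have mX i : measurable_fun setT (X i : Omega -> R) by exact: measurable_funPT.
have mY i : measurable_fun setT (Y i : Omega -> R) by exact: measurable_funPT.
have Ex_XY (f : R -> R) i : measurable_fun setT f ->
    Ex P (fun w => f (X i w)) = Ex P (fun w => f (Y i w)).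
  move=> mf; apply: Ex_ae; try exact: measurableT_comp.
  by apply: filterS XY => w ->.
pose mu := Ex P (Y 0%N).
have EX0 : fine 'E_P[X 0%N] = mu.
  by rewrite -ExE; exact: (Ex_XY id 0%N (@measurable_id _ _ setT)).
have msub c : measurable_fun setT (fun x : R => (x - c) ^+ 2).
  by apply: measurable_funX; exact: measurable_funB.
have VX0 : fine 'V_P[X 0%N] = Ex P (fun w => (Y 0%N w - mu) ^+ 2).
  rewrite /variance unlock -ExE -EX0 -(Ex_XY _ 0%N (msub _)).
  by congr (Ex P _); apply/funext => w /=; rewrite expr2.
have Ylow i w : a <= Y i w by have /andP[] := Y_ab i w.
have bY i w : `|Y i w| <= Num.max a b.
  by have /andP[] := Y_ab i w; rewrite ler_norml; lra.
have IY i : intg P (Y i) by exact: intg_bounded (mY i) (bY i).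
have mu0 : 0 < mu.
  apply: lt_le_trans a_gt0 _; rewrite -[leLHS](Ex_cst P).
  by apply: Ex_le => //; exact: intg_cst.
pose s1 := Num.sqrt (Ex P (fun w => (Y 0%N w - mu) ^+ 2)).
have V0 : 0 <= Ex P (fun w => (Y 0%N w - mu) ^+ 2).
  by apply: Ex_ge0 => w; exact: sqr_ge0.
have varY : Ex P (fun w => (Y 0%N w - mu) ^+ 2) = s1 ^+ 2 by rewrite sqr_sqrtr.
have sigma2 : sigma ^+ 2 = (2 * mu * s1) ^+ 2.
  by rewrite sigma2E EX0 VX0 varY; ring.
have s1_ge0 : 0 <= s1 by exact: sqrtr_ge0.
have sigmaE : sigma = 2 * mu * s1.
  have ms0 : 0 <= 2 * mu * s1 by rewrite !mulr_ge0 // ltW.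
  by have /eqP := sigma2; rewrite (eqrXn2 _ (ltW sigma_gt0) ms0) // => /eqP.
have s1_gt0 : 0 < s1.
  rewrite lt_def s1_ge0 andbT; apply: contraTneq sigma_gt0 => s10.
  by rewrite sigmaE s10 mulr0 ltxx.
have ms : measurable_fun setT s := s_L4.1.
have s_L2 : intg P (fun w => s (Y 0%N w) ^+ 2).
  have msX : measurable_fun setT (fun w => s (X 0%N w)) by exact: measurableT_comp.
  apply: (@intg_ae _ _ _ P (fun w => s (X 0%N w) ^+ 2)).
  - exact: measurable_funX.
  - by apply: measurable_funX; exact: measurableT_comp.
  - by apply: filterS XY => w ->.
  have I4 : intg P (fun w => `|s (X 0%N w)| ^+ 4).
    apply/integrableP; split.
      apply/measurable_EFinP; apply: measurable_funX; exact: measurableT_comp.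
    have := s_L4.2; rewrite unlock; apply: le_lt_trans.
    rewrite le_eqVlt; apply/orP; left; apply/eqP; apply: eq_integral => w _.
    by rewrite /= ger0_norm ?exprn_ge0 // -powR_mulrn.
  apply: intg_dom (intgD (intg_cst P 1) I4) => [|w]; first exact: measurable_funX.
  rewrite normrX; set t := `|_|.
  have := sqr_ge0 (t ^+ 2 - 1); have := sqr_ge0 (t ^+ 2); rewrite -exprM /=; nra.
have s_ibp v h M L : 0 < h -> 0 < L ->
    Ex P (fun w => s (Y 0%N w) * testfun v h M L (Y 0%N w)) =
    - Ex P (fun w => testfun' v h M L (Y 0%N w)).
  move=> h0 L0.
  rewrite -(Ex_XY (fun x => s x * testfun v h M L x) 0%N); last first.
    by apply: measurable_funM => //; exact: measurable_testfun.
  rewrite -(Ex_XY (testfun' v h M L) 0%N (measurable_testfun' _ _ _ _)).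
  rewrite !ExE s_score.2 ?fineN; last exact: testfun_Cc.
  congr (- fine 'E_P[_]); apply/funext => w; rewrite derive1E.
  by case: (is_derive_testfun v h M L (X 0%N w)).
have bound := @Ustat_c_close _ _ _ P Y s a (Num.max a b) s1
  (clip_indep a b X_indep) (clip_id_distrib a b X_id) a_gt0 Y_ab ms s_L2 s_ibp s1_gt0 varY.
pose K := nsum_const Y s a (Num.max a b) s1 + 500 * Ustat_const Y (Num.max a b) s1.
(* Only off-diagonal pairs occur in the statistic, and for these independence replaces each centring
   constant by [mu ^+ 2], the form used by [Ustat_c]. *)
have EYY i j : i != j -> Ex P (fun w => Y i w * Y j w) = mu ^+ 2.
  move=> ij; have EY k : Ex P (Y k) = mu.
    exact: (id_Ex (clip_id_distrib a b X_id) k (@measurable_id _ _ setT) (IY 0%N)).2.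
  transitivity (Ex P (fun w => mu * Y j w)); last by rewrite ExZ ?EY.
  have YI : mutually_independent Y by exact: clip_indep.
  have Iij : indep P (Y i) (Y j) := indep_pair YI ij.
  apply: (indep_Ex_eq (mY i) (mY j) (F := fun z => z.1 * z.2)
    (G := fun z => mu * z.2) Iij) => //.
  - by apply: measurable_funM.
  - by apply: measurable_funM.
  - apply: (@intg_bounded _ _ _ _ _ (Num.max a b * Num.max a b)).
      exact: measurable_funM.
    by move=> w; rewrite /= normrM; apply: ler_pM => //; exact: bY.
  - exact: (intgZ mu (IY j)).
  - by move=> y /=; under eq_fun do rewrite mulrC; exact: (intgZ y (IY i)).
  - by move=> y; exact: (intg_cst P (mu * y)).
  move=> y /=; rewrite Ex_cst; under eq_fun do rewrite mulrC.
  by rewrite (ExZ y (IY i)) EY mulrC.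
have UXE n w : Ustat X n w = (Num.sqrt n%:R * (n%:R - 1))^-1 *
    \sum_(i < n) \sum_(j < n | j != i) (X i w * X j w - mu ^+ 2).
  rewrite /Ustat; congr (_ * _); apply: eq_bigr => i _; apply: eq_bigr => j ji.
  congr (_ - _); rewrite -ExE -(@EYY i j); last by rewrite eq_sym.
  apply: Ex_ae; try exact: measurable_funM.
  by apply: filterS XY => w' E; rewrite !E.
have mU (Z : nat -> {RV P >-> R}) n : measurable_fun setT
    (fun w => (Num.sqrt n%:R * (n%:R - 1))^-1 *
      \sum_(i < n) \sum_(j < n | j != i) (Z i w * Z j w - mu ^+ 2)).
  have mZ i : measurable_fun setT (Z i : Omega -> R) by exact: measurable_funPT.
  apply: measurable_funM => //; apply: measurable_sum => i.
  under eq_fun do rewrite big_mkcond; apply: measurable_sum => j.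
  case: (j != i) => //=; apply: measurable_funB => //; exact: measurable_funM.
have UE n u : fine (P [set w | sigma * u < Ustat X n w]) =
    pr P [set w | 2 * mu * s1 * u < Ustat_c Y n w].
  rewrite -/(pr P _) sigmaE; apply: pr_ae.
  - by apply: measurable_gt; rewrite (funext (UXE n)); exact: mU.
  - by apply: measurable_gt; exact: mU.
  - apply: filterS XY => w E; rewrite UXE /Ustat_c -/mu; congr (_ < _ * _).
    by apply: eq_bigr => i _; apply: eq_bigr => j _; rewrite !E.
set C := Num.sqrt 2 * fine 'E_P[fun w => (X 0%N w ^+ 4)%R]%E / sigma ^+ 2.
(* Strict positivity is what allows the factor [ln n] to dominate the constant [K]; it follows from
   [X_1^4 >= a^4 > 0] almost surely. *)
have C0 : 0 < C * (8 * Num.sqrt 2 + 2).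
  have E4 : 0 < fine 'E_P[fun w => (X 0%N w ^+ 4)%R]%E.
    rewrite -ExE (Ex_XY (fun x => x ^+ 4)); last exact: measurable_funX.
    apply: lt_le_trans (_ : 0 < a ^+ 4) _; first by rewrite exprn_gt0.
    rewrite -[leLHS](Ex_cst P); apply: Ex_le; first exact: intg_cst.
      apply: (@intg_bounded _ _ _ _ _ (Num.max a b ^+ 4)); first exact: measurable_funX.
      by move=> w; rewrite normrX lerXn2r ?nnegrE // (le_trans (normr_ge0 (Y 0%N w))).
    move=> w; rewrite lerXn2r ?nnegrE ?(ltW a_gt0) //.
    exact: le_trans (ltW a_gt0) (Ylow _ _).
  have c1 : 0 < 8 * Num.sqrt 2 + 2 :> R by have := sqrtr_ge0 (2 : R); lra.
  apply: mulr_gt0 c1; apply: divr_gt0; last by rewrite exprn_gt0.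
  by apply: mulr_gt0 => //; rewrite sqrtr_gt0.
(* [log n] exceeds any constant, so that no remainder is needed. *)
exists (fun=> 0).
  by rewrite littleoE //; exact: littleo0_subproof.
near=> n => u; rewrite addr0 UE.
have n1 : (1 < n)%N by near: n; exact: nbhs_infty_gt.
have n0 : 0 < n%:R :> R by rewrite ltr0n ltnW.
have sq0 : 0 < Num.sqrt n%:R :> R by rewrite sqrtr_gt0.
have hn : Ustat_const Y (Num.max a b) s1 / Num.sqrt n%:R <= 4^-1.
  rewrite ler_pdivrMr // mulrC ler_pdivlMr //; apply: le_trans (ler_norm _) _.
  rewrite -sqrtr_sqr ler_wsqrtr //; near: n; exact: nbhs_infty_ger.
apply: le_trans (bound n n1 u hn) _; rewrite -/K.
(* After cancelling [sqrt n], the claim is that [ln n] exceeds a fixed constant, that is, that [n]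
   exceeds its exponential. This threshold does not involve [u], so the bound is uniform. *)
rewrite -mulrA mulrAC ler_pM2r ?invr_gt0 // -ler_pdivrMr //.
rewrite -ler_expR lnK ?posrE //; near: n; exact: nbhs_infty_ger.
Unshelve. all: by end_near. Qed.
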